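(* Let $A$ be a formal cdga and $V$ a dg vector space (in (2) and (4), $V$ is moreover endowed with a symmetric non-degenerate scalar product). (1) An element of $\mathrm{MC}(\tilde{\mathfrak c}(V),A)$ is an $A$-linear $L_\infty$ structure on $V$ together with a choice of an element of $\mathrm{MC}(V,A)$. (2) An element of $\mathrm{MC}(\widetilde{\mathfrak{cs}}(V),A)$ is an $A$-linear cyclic $L_\infty$ structure on $V$ together with a choice of an element of $\mathrm{MC}(V,A)$. (3) An element of $\mathrm{MC}(\tilde{\mathfrak a}(V),A)$ is an $A$-linear $A_\infty$ structure on $V$ together with a choice of an element of $\mathrm{MC}(V,A)$. (4) An element of $\mathrm{MC}(\widetilde{\mathfrak{as}}(V),A)$ is an $A$-linear cyclic $A_\infty$ structure on $V$ together with a choice of an element of $\mathrm{MC}(V,A)$. Here an element of the relevant MC set is written as $g+\xi$ with $g$ in the Lie algebra summand and $\xi\in A_+\otimes\Pi V$; $g$ is the infinity-structure and $\xi$ is the MC element in it.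
   Context: $\mathbf k$ is a field of characteristic $0$; all vector spaces are $\mathbb Z/2$-graded, dg means differential $\mathbb Z/2$-graded, $\Pi$ is parity reversion, Koszul signs are used throughout. A formal cdga $A$ is obtained by adjoining a unit to an inverse limit $A_+$ of finite-dimensional nilpotent non-unital commutative dg algebras; tensor products with $A_+$ are completed. An $L_\infty$ structure on a dg vector space $(U,d)$ is a collection of odd (super)symmetric maps $m_n:(\Pi U)^{\otimes n}\to\Pi U$, $n\ge1$, equivalently an odd continuous derivation $m$ of the completed symmetric algebra $\hat S\Pi U^*$ without constant term (whose components $\Pi U^*\to\hat S^n\Pi U^*$ are dual to $m_n$), with $d(m)+\frac12[m,m]=0$, i.e. $[d,m_n]+\sum_{k+l=n+1}\sum_{\mathrm{Sh}(l,k-1)}\pm m_k(m_l(\dots),\dots)=0$. An $A_\infty$ structure is the analogous notion with no symmetry condition and with the completed tensor algebra $\hat T\Pi U^*$. In the $A$-linear version, $m$ takes values in $A_+$: $m_n:(\Pi U)^{\otimes n}\to A_+\otimes \Pi U$ and the differential includes $d_A$. Given an $A$-linear $L_\infty$ structure on $U$ (in particular any $L_\infty$ structure, extended $A$-multilinearly), $\mathrm{MC}(U,A)$ is the set of even $\xi\in A_+\otimes\Pi U$ with $d(\xi)+\sum_{i\ge1}\frac1{i!}m_i(\xi^{\otimes i})=0$, where $d=d_A\otimes \mathrm{id}+\mathrm{id}\otimes d_{\Pi U}$; in the $A_\infty$ case the equation is $d(\xi)+\sum_{i\ge1}m_i(\xi^{\otimes i})=0$. $\mathfrak c(V)$ is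 the dg Lie algebra of continuous derivations of $\hat S\Pi V^*$ vanishing at zero (no constant term), identified with $\prod_{n\ge1}\mathrm{Hom}(S^n\Pi V,\Pi V)$, with bracket the graded commutator $[g,h]=g\circ h-(-1)^{|g||h|}h\circ g$, where $(g\circ h)(w_1,\dots)=\sum_{\text{shuffles}}\pm g(h(w_I),w_J)$. $\mathfrak a(V)$ is the dg Lie algebra of continuous derivations of $\hat T\Pi V^*$ vanishing at zero, identified with $\prod_{n\ge1}\mathrm{Hom}((\Pi V)^{\otimes n},\Pi V)$ with bracket the graded commutator of the insertion product $g\circ h=\sum_i g\circ_i h$. There is a dg Lie map $\mathfrak a(V)\to\mathfrak c(V)$ obtained by passing from $\hat T\Pi V^*$ to its quotient $\hat S\Pi V^*$; on multilinear maps it is symmetrization $g\mapsto \bar g=\sum_\sigma \pm g\circ \sigma$ (no normalizing factor). If $V$ has a symmetric non-degenerate scalar product, equivalently $\Pi V$ has a linear symplectic form $\omega$, then $\mathfrak{cs}(V)\subset\mathfrak c(V)$ (resp. $\mathfrak{as}(V)\subset\mathfrak a(V)$) is the dg Lie subalgebra of symplectic derivations, i.e. those whose components $g_n$ are such that $\omega(g_n(x_1,\dots,x_n),x_{n+1})$ is symmetric (resp. cyclically invariant) with Koszul signs. A cyclic $L_\infty$ (resp. $A_\infty$) structure is an $L_\infty$ (resp. $A_\infty$) structure that is a symplectic derivation. For $\mathfrak g=\mathfrak c(V),\mathfrak{cs}(V),\mathfrak a(V),\mathfrak{as}(V)$, the $L_\infty$ algebra $\tilde{\mathfrak g}(V)$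 has underlying dg space $\mathfrak g\oplus V$ and $L_\infty$ products as follows: on $\Pi\mathfrak g$, $m_2$ is the parity shift of the Lie bracket, $m_2(\Pi g,\Pi h)=(-1)^{|g|}\Pi[g,h]$, and the other products on elements of $\Pi\mathfrak g$ only are zero; on $\Pi V$ all products are zero; the only other non-zero products (up to symmetry) are $m_n(\Pi g,w_1,\dots,w_{n-1})=g(w_1,\dots,w_{n-1})\in \Pi V$ for $w_i\in\Pi V$, $n\ge 2$, and $g$ of arity $n-1$, where in the cases of $\mathfrak a(V)$, $\mathfrak{as}(V)$ the right-hand side is replaced by $\bar g(w_1,\dots,w_{n-1})$. An element of $A_+\otimes\Pi\mathfrak g$ is identified, by parity shift, with an element of $A_+\otimes\mathfrak g$, i.e. with a collection of maps $(\Pi V)^{\otimes n}\to A_+\otimes\Pi V$. *)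

(* Defs.v *)
From HB Require Import structures.
From mathcomp Require Import all_boot all_order all_fingroup all_algebra.
From mathcomp Require Import boolp classical_sets functions.
Set Implicit Arguments.
Unset Strict Implicit.
Unset Printing Implicit Defensive.
Import GRing.Theory.
Local Open Scope ring_scope.

(* Parities are booleans: [false] is even, [true] is odd, and [addb] adds
   them; [(-1) ^+ (b && c)] is the Koszul sign (-1)^(bc). *)

Definition par (e : seq bool) : bool := foldr addb false e.

(* [gpr b] is the projection onto the component of parity [b]. *)
Record dgStruct (k : fieldType) (V : lmodType k) := DgStruct {
  gpr : bool -> {linear V -> V};
  dif : {linear V -> V};
  gpr_gpr : forall b c x, gpr b (gpr c x) = if b == c then gpr c x else 0;
  gpr_sum : forall x, gpr false x + gpr true x = x;
  dif_gpr : forall b x, dif (gpr b x) = gpr (~~ b) (dif x);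
  dif_dif : forall x, dif (dif x) = 0 }.

Record dgSpace (k : fieldType) := DgSpace {
  dg_sort :> lmodType k;
  dg_str :> dgStruct dg_sort }.

Definition hom (k : fieldType) (V : lmodType k) (D : dgStruct V) (b : bool)
  (x : V) : Prop := gpr D b x = x.

(* Parity reversion: same vectors, opposite parities, differential -d. *)
Section ParityReversion.
Variables (k : fieldType) (V : lmodType k) (D : dgStruct V).

Definition pi_dif (x : V) : V := - dif D x.

Lemma pi_dif_linear : linear pi_dif.
Proof. by move=> a x y; rewrite /pi_dif linearP opprD scalerN. Qed.

HB.instance Definition _ := GRing.isLinear.Build k V V _ pi_dif pi_dif_linear.

Lemma pi_gpr_gpr b c x : gpr D (~~ b) (gpr D (~~ c) x) =
  if b == c then gpr D (~~ c) x else 0.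
Proof. by rewrite gpr_gpr; case: b; case: c. Qed.

Lemma pi_gpr_sum x : gpr D (~~ false) x + gpr D (~~ true) x = x.
Proof. by rewrite addrC gpr_sum. Qed.

Lemma pi_dif_gpr b x : pi_dif (gpr D (~~ b) x) = gpr D (~~ ~~ b) (pi_dif x).
Proof. by rewrite /pi_dif dif_gpr linearN. Qed.

Lemma pi_dif_dif x : pi_dif (pi_dif x) = 0.
Proof. by rewrite /pi_dif linearN opprK dif_dif. Qed.

Definition pi_str : dgStruct V :=
  @DgStruct k V (fun b => gpr D (~~ b)) pi_dif
    pi_gpr_gpr pi_gpr_sum pi_dif_gpr pi_dif_dif.
End ParityReversion.

Definition Pi (k : fieldType) (V : dgSpace k) : dgSpace k :=
  DgSpace (pi_str (dg_str V)).

(* The operator x |-> (-1)^(q |x|) x. *)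
Definition tau (k : fieldType) (V : dgSpace k) (q : bool) (x : V) : V :=
  gpr V false x + (-1) ^+ q *: gpr V true x.

Record nilcdga (k : fieldType) := NilCdga {
  nc_sort :> vectType k;
  nc_str : dgStruct nc_sort;
  nc_mul : nc_sort -> nc_sort -> nc_sort;
  nc_mulDl : forall a x y z,
    nc_mul (a *: x + y) z = a *: nc_mul x z + nc_mul y z;
  nc_mulDr : forall a x y z,
    nc_mul z (a *: x + y) = a *: nc_mul z x + nc_mul z y;
  nc_mulA : forall x y z, nc_mul x (nc_mul y z) = nc_mul (nc_mul x y) z;
  nc_mul_hom : forall b c x y, hom nc_str b x -> hom nc_str c y ->
    hom nc_str (b (+) c) (nc_mul x y);
  nc_mulC : forall b c x y, hom nc_str b x -> hom nc_str c y ->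
    nc_mul x y = (-1) ^+ (b && c) *: nc_mul y x;
  nc_leibniz : forall b x y, hom nc_str b x ->
    dif nc_str (nc_mul x y) =
      nc_mul (dif nc_str x) y + (-1) ^+ b *: nc_mul x (dif nc_str y);
  nc_nilpotent : exists N, forall x (s : seq nc_sort),
    size s = N -> foldl nc_mul x s = 0 }.

(* A homogeneous basis of a nilpotent algebra, and the basis of its
   unitization obtained by adding the unit [None]; [umul], [udif] and [utr]
   are the matrices, in these bases, of the product, of the differential and
   of (the unital extension of) a map. *)
Section Basis.
Variable k : fieldType.

Definition hpart (A : nilcdga k) (b : bool) : {vspace A} :=
  limg (linfun (gpr (nc_str A) b)).

Definition hbasis (A : nilcdga k) : finType := {b : bool & 'I_(\dim (hpart A b))}.

Definition bvec (A : nilcdga k) (j : hbasis A) : A :=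
  (vbasis (hpart A (tag j)))`_(tagged j).

Definition bcoord (A : nilcdga k) (x : A) (j : hbasis A) : k :=
  coord (vbasis (hpart A (tag j))) (tagged j) (gpr (nc_str A) (tag j) x).

Definition ubasis (A : nilcdga k) : finType := option (hbasis A).

Definition upar (A : nilcdga k) (a : ubasis A) : bool :=
  if a is Some j then tag j else false.

(* The coefficient of [e_c] in [e_a * e_b]. *)
Definition umul (A : nilcdga k) (a b c : ubasis A) : k :=
  match a, b, c with
  | None, _, _ => (b == c)%:R
  | _, None, _ => (a == c)%:R
  | Some i, Some j, Some l => bcoord (nc_mul (bvec i) (bvec j)) l
  | _, _, _ => 0
  end.

(* The coefficient of [e_c] in [d e_b]. *)
Definition udif (A : nilcdga k) (b c : ubasis A) : k :=
  match b, c with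
  | Some j, Some l => bcoord (dif (nc_str A) (bvec j)) l
  | _, _ => 0
  end.

(* The coefficient of [e_c] in [f e_b]. *)
Definition utr (A B : nilcdga k) (f : A -> B) (b : ubasis A) (c : ubasis B) : k :=
  match b, c with
  | None, None => 1
  | Some j, Some l => bcoord (f (bvec j)) l
  | _, _ => 0
  end.
End Basis.

(* An inverse system, over a directed preorder, presenting the maximal ideal
   A_+; [fc_tr i j] is only meaningful when [fc_le i j]. *)
Record formal_cdga (k : fieldType) := FormalCdga {
  fc_idx : Type;
  fc_le : fc_idx -> fc_idx -> Prop;
  fc_inhab : inhabited fc_idx;
  fc_le_refl : forall i, fc_le i i;
  fc_le_trans : forall i j l, fc_le i j -> fc_le j l -> fc_le i l;
  fc_directed : forall i j, exists l, fc_le i l /\ fc_le j l;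
  fc_lev :> fc_idx -> nilcdga k;
  fc_tr : forall i j, {linear fc_lev j -> fc_lev i};
  fc_tr_gpr : forall i j, fc_le i j -> forall b x,
    fc_tr i j (gpr (nc_str (fc_lev j)) b x) =
      gpr (nc_str (fc_lev i)) b (fc_tr i j x);
  fc_tr_dif : forall i j, fc_le i j -> forall x,
    fc_tr i j (dif (nc_str (fc_lev j)) x) =
      dif (nc_str (fc_lev i)) (fc_tr i j x);
  fc_tr_mul : forall i j, fc_le i j -> forall x y,
    fc_tr i j (nc_mul x y) = nc_mul (fc_tr i j x) (fc_tr i j y);
  fc_tr_id : forall i x, fc_tr i i x = x;
  fc_tr_comp : forall i j l, fc_le i j -> fc_le j l -> forall x,
    fc_tr i j (fc_tr j l x) = fc_tr i l x }.

(* An element sum_a e_a (x) t_a of (k + A_i) (x) U is the family t of its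
   coordinates, since A_i is finite-dimensional.  The completed tensor product
   of A with U is the inverse limit of these spaces: the set of the families
   satisfying [compatible].  It contains the completed tensor product of A_+
   with U, where moreover the coordinates along the unit vanish. *)
Definition tens (k : fieldType) (A : formal_cdga k) (U : lmodType k) : Type :=
  forall i : fc_idx A, ubasis (A i) -> U.

Section Tensor.
Variables (k : fieldType) (A : formal_cdga k) (U : lmodType k).

Definition compatible (t : tens A U) : Prop :=
  forall i j, fc_le i j -> forall c,
    t i c = \sum_(b : ubasis (A j)) utr (fc_tr i j) b c *: t j b.

Definition in_Aplus (t : tens A U) : Prop :=
  compatible t /\ forall i, t i None = 0.
End Tensor.

(* 1 (x) u *)
Definition unit_tens (k : fieldType) (A : nilcdga k) (U : lmodType k) (u : U)
  (a : ubasis A) : U := if a is None then u else 0.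

(* A graded space given by its subspaces of homogeneous vectors inside an
   ambient vector space, and the values of its differential on vectors of a
   given parity. *)
Record homData (k : fieldType) := HomData {
  hd_sort :> lmodType k;
  hd_hom : bool -> hd_sort -> Prop;
  hd_dif : bool -> hd_sort -> hd_sort }.

Definition dg_homData (k : fieldType) (W : dgSpace k) : homData k :=
  @HomData k W (hom W) (fun _ => dif W).

(* Operations act on lists of homogeneous vectors, each listed with its
   parity. *)
Definition homs (k : fieldType) (U : homData k) (s : seq (bool * U)) : Prop :=
  forall p, p \in s -> hd_hom p.1 p.2.

Section Level.
Variables (k : fieldType) (A : nilcdga k) (U : homData k).

(* (d_A (x) id + id (x) d_U) t, for t of parity [p] *)
Definition tens_dif (p : bool) (t : ubasis A -> U) (c : ubasis A) : U :=
  \sum_(b : ubasis A) udif b c *: t b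
  + (-1) ^+ upar c *: hd_dif (p (+) upar c) (t c).

(* e_a t *)
Definition tens_scale (a : ubasis A) (t : ubasis A -> U) (c : ubasis A) : U :=
  \sum_(b : ubasis A) umul a b c *: t b.

(* The A-multilinear extension of an operation [m] of parity [q], evaluated at
   homogeneous tensors (each listed with its parity): since
     m(e_a (x) u, ...) = (-1)^(q |a|) e_a m(u, ...),
   the first argument is expanded on the basis, and m(u, ...) is an operation
   of parity q + |u| in the remaining arguments. *)
Fixpoint ext (q : bool) (m : seq (bool * U) -> ubasis A -> U)
    (ts : seq (bool * (ubasis A -> U))) (c : ubasis A) {struct ts} : U :=
  match ts with
  | [::] => m [::] c
  | (p, t) :: ts' =>
      \sum_(a : ubasis A) (-1) ^+ (q && upar a) *:
        tens_scale a (ext (q (+) p (+) upar a)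
                          (fun s => m ((p (+) upar a, t a) :: s)) ts') c
  end.
End Level.

(* [U] is the parity reversion of the space carrying the structure [m].  In
   every A_i the sum of the series is that of its large enough partial sums. *)
Definition MC_set (k : fieldType) (A : formal_cdga k) (U : homData k)
    (coef : nat -> k) (m : seq (bool * U) -> tens A U) : set (tens A U) :=
  fun xi =>
  [/\ in_Aplus xi,
      forall i (a : ubasis (A i)), hd_hom (upar a) (xi i a) &
      forall i, exists N0, forall N, (N0 <= N)%N -> forall c,
        tens_dif false (xi i) c
        + \sum_(1 <= n < N.+1)
            coef n *: ext true (fun s => m s i) (nseq n (false, xi i)) c = 0].

Definition MC_Linfty (k : fieldType) (A : formal_cdga k) (U : homData k)
    (m : seq (bool * U) -> tens A U) : set (tens A U) :=
  MC_set (fun n => (n`!%:R)^-1) m.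

Definition MC_Ainfty (k : fieldType) (A : formal_cdga k) (U : homData k)
    (m : seq (bool * U) -> tens A U) : set (tens A U) :=
  MC_set (fun=> 1) m.

(* A k-linear operation, extended A-linearly. *)
Definition const_op (k : fieldType) (A : formal_cdga k) (U : homData k)
  (m : seq (bool * U) -> U) (s : seq (bool * U)) : tens A U :=
  fun i => @unit_tens k (A i) U (m s).

Definition untagged (T X : Type) (m : seq T -> X) (s : seq (bool * T)) : X :=
  m (unzip2 s).

(* A collection of maps W^n -> X, n >= 1, is a function on lists that vanishes
   on the empty list; its n-ary component is its restriction to the lists of
   size n. *)

Section Signs.
Variables (k : fieldType) (W : dgSpace k).

Definition multilin (X : lmodType k) (f : seq W -> X) : Prop :=
  f [::] = 0 /\
  forall s t a x y,
    f (s ++ (a *: x + y) :: t) = a *: f (s ++ x :: t) + f (s ++ y :: t).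

(* Multilinear extension of a map given on homogeneous vectors. *)
Definition from_homs (X : lmodType k) (F : seq (bool * W) -> X) (s : seq W) : X :=
  \sum_(e : (size s).-tuple bool) F [seq (p.1, gpr W p.1 p.2) | p <- zip e s].

Definition permute (T : Type) (s : seq T) (sigma : 'S_(size s)) : seq T :=
  [seq tnth (in_tuple s) (sigma i) | i <- enum 'I_(size s)].

(* Koszul sign of the passage from [s] to [permute sigma]: the parity of the
   number of inversions of pairs of odd vectors. *)
Definition perm_sign (s : seq (bool * W)) (sigma : 'S_(size s)) : bool :=
  odd #|[set ij : 'I_(size s) * 'I_(size s) |
          [&& (ij.1 < ij.2)%N, (sigma ij.2 < sigma ij.1)%N,
              (tnth (in_tuple s) (sigma ij.1)).1
            & (tnth (in_tuple s) (sigma ij.2)).1]]|.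

Definition symmetric_map (X : lmodType k) (f : seq W -> X) : Prop :=
  forall s : seq (bool * W), @homs k (dg_homData W) s ->
  forall sigma : 'S_(size s),
    f (unzip2 s) = (-1) ^+ perm_sign sigma *: f (unzip2 (permute sigma)).

Definition cyclic_map (X : lmodType k) (f : seq W -> X) : Prop :=
  forall (s : seq (bool * W)) (p : bool * W),
    @homs k (dg_homData W) (rcons s p) ->
    f (unzip2 (rcons s p)) =
      (-1) ^+ (p.1 && par (unzip1 s)) *: f (unzip2 (p :: s)).

Definition symmetrize (g : seq W -> W) : seq W -> W :=
  from_homs (fun s => \sum_(sigma : 'S_(size s))
    (-1) ^+ perm_sign sigma *: g (unzip2 (permute sigma))).

(* A subset I of the arguments is a mask; this is the sign of moving the
   selected arguments, in order, in front of the other ones. *)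
Fixpoint shuffle_sign (m e : seq bool) : bool :=
  match m, e with
  | true :: m', _ :: e' => shuffle_sign m' e'
  | false :: m', b :: e' => (b && par (mask m' e')) (+) shuffle_sign m' e'
  | _, _ => false
  end.

(* [d, g] for g of parity p, i.e. d g - (-1)^p g d *)
Definition insert_dif (X : lmodType k) (g : seq W -> X) (s : seq W) : X :=
  \sum_(i < size s)
    g (map (tau true) (take i s) ++ dif W s`_i :: drop i.+1 s).

Definition der_dif (p : bool) (g : seq W -> W) (s : seq W) : W :=
  dif W (g s) - (-1) ^+ p *: insert_dif g s.

Definition comp_shuffle (g h : seq W -> W) (s : seq (bool * W)) : W :=
  \sum_(m : (size s).-tuple bool | true \in m)
    (-1) ^+ shuffle_sign m (unzip1 s) *:
      g (h (unzip2 (mask m s)) :: unzip2 (mask (map negb m) s)).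

(* [h] has parity [q]. *)
Definition comp_insert (q : bool) (g h : seq W -> W) (s : seq W) : W :=
  \sum_(i < size s) \sum_(l < size s - i)
    g (map (tau q) (take i s)
       ++ h (take l.+1 (drop i s)) :: drop (i + l.+1) s).

(* the brackets of c(V) and a(V), for g of parity p and h of parity q *)
Definition bracket_c (p q : bool) (g h : seq W -> W) (s : seq W) : W :=
  from_homs (comp_shuffle g h) s
  - (-1) ^+ (p && q) *: from_homs (comp_shuffle h g) s.

Definition bracket_a (p q : bool) (g h : seq W -> W) (s : seq W) : W :=
  comp_insert q g h s - (-1) ^+ (p && q) *: comp_insert p h g s.

(* The elements of parity [b] of a(V), c(V), as(V) and cs(V), for W the parity
   reversion of V; [om] is a bilinear form on W. *)
Definition in_a (b : bool) (g : seq W -> W) : Prop :=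
  multilin g /\
  forall s : seq (bool * W), @homs k (dg_homData W) s ->
    hom W (b (+) par (unzip1 s)) (g (unzip2 s)).

Definition in_c (b : bool) (g : seq W -> W) : Prop :=
  in_a b g /\ symmetric_map g.

(* om(g(x_1, ..., x_n), x_(n+1)), as a map of n + 1 arguments *)
Definition form_of (om : W -> W -> k) (g : seq W -> W) (s : seq W) : k^o :=
  if s is x :: s' then om (g (belast x s')) (last x s') else 0.

Definition in_as (om : W -> W -> k) (b : bool) (g : seq W -> W) : Prop :=
  in_a b g /\ cyclic_map (form_of om g).

Definition in_cs (om : W -> W -> k) (b : bool) (g : seq W -> W) : Prop :=
  in_c b g /\ symmetric_map (form_of om g).
End Signs.

(* The form may be even or odd, and it is compatible with the differential.
   Non-degeneracy is injectivity of V -> V^*, as V may be infinite-dimensional. *)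
Record scalarProduct (k : fieldType) (V : dgSpace k) := ScalarProduct {
  sp :> V -> V -> k;
  sp_par : bool;
  sp_linl : forall a x y z, sp (a *: x + y) z = a * sp x z + sp y z;
  sp_linr : forall a x y z, sp z (a *: x + y) = a * sp z x + sp z y;
  sp_hom : forall b c x y, hom V b x -> hom V c y ->
    b (+) c != sp_par -> sp x y = 0;
  sp_sym : forall b c x y, hom V b x -> hom V c y ->
    sp x y = (-1) ^+ (b && c) * sp y x;
  sp_nondeg : forall x, (forall y, sp x y = 0) -> x = 0;
  sp_dif : forall b x y, hom V b x ->
    sp (dif V x) y + (-1) ^+ b * sp x (dif V y) = 0 }.

(* omega(Pi x, Pi y) = (-1)^|x| <x, y>, with |x| the parity of x in V *)
Definition omega (k : fieldType) (V : dgSpace k) (B : scalarProduct V)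
  (x y : Pi V) : k := B (@tau k V true x) y.

Section Structures.
Variables (k : fieldType) (A : formal_cdga k) (W : dgSpace k).
Implicit Type m : seq W -> tens A W.
Local Notation HW := (dg_homData W).

(* The differential of [m] and the composition of [m] with itself, evaluated
   at homogeneous arguments; [m] is odd. *)
Definition str_dif m i (s : seq (bool * W)) (c : ubasis (A i)) : W :=
  @tens_dif k (A i) HW (~~ par (unzip1 s)) (m (unzip2 s) i) c
  + insert_dif (fun s' => m s' i c) (unzip2 s).

Definition units i (s : seq (bool * W)) : seq (bool * (ubasis (A i) -> W)) :=
  [seq (p.1, unit_tens p.2) | p <- s].

Definition str_shuffle m i (s : seq (bool * W)) (c : ubasis (A i)) : W :=
  \sum_(e : (size s).-tuple bool | true \in e)
    (-1) ^+ shuffle_sign e (unzip1 s) *: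
      @ext k (A i) HW true (untagged (fun s' => m s' i))
        ((~~ par (unzip1 (mask e s)), m (unzip2 (mask e s)) i)
         :: units i (mask (map negb e) s)) c.

Definition str_insert m i (s : seq (bool * W)) (c : ubasis (A i)) : W :=
  \sum_(r < size s) \sum_(l < size s - r)
    let s1 := [seq (p.1, tau true p.2) | p <- take r s] in
    let s2 := take l.+1 (drop r s) in
    let s3 := drop (r + l.+1) s in
    @ext k (A i) HW true (untagged (fun s' => m s' i))
      (units i s1
       ++ (~~ par (unzip1 s2), m (unzip2 s2) i) :: units i s3) c.

(* [m] takes values in A_+ (x) W and is odd: its coordinate along a basis
   vector of parity b is homogeneous of parity b + 1. *)
Definition Linfty m : Prop :=
  [/\ forall s, in_Aplus (m s),
      forall i (a : ubasis (A i)), in_c (~~ upar a) (fun s => m s i a) &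
      forall s, @homs k HW s -> forall i c,
        str_dif m s c + @str_shuffle m i s c = 0].

Definition Ainfty m : Prop :=
  [/\ forall s, in_Aplus (m s),
      forall i (a : ubasis (A i)), in_a (~~ upar a) (fun s => m s i a) &
      forall s, @homs k HW s -> forall i c,
        str_dif m s c + @str_insert m i s c = 0].

Definition cyclic_Linfty (om : W -> W -> k) m : Prop :=
  Linfty m /\
  forall i (a : ubasis (A i)), in_cs om (~~ upar a) (fun s => m s i a).

Definition cyclic_Ainfty (om : W -> W -> k) m : Prop :=
  Ainfty m /\
  forall i (a : ubasis (A i)), in_as om (~~ upar a) (fun s => m s i a).
End Structures.

(* The ambient space consists of the pairs (g, w) standing for
   Pi g + w in Pi g + Pi V; the homogeneous vectors are those whose first
   component lies in the dg Lie algebra, described by [mem], and whose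
   components have the right parity.  The operations are given by formulas on
   the ambient space that preserve these subspaces.  [br] is the bracket and [act g] is g for
   c(V), cs(V), and its symmetrization for a(V), as(V). *)
Section Tilde.
Variables (k : fieldType) (W : dgSpace k).
Variable mem : bool -> (seq W -> W) -> Prop.
Variable br : bool -> bool -> (seq W -> W) -> (seq W -> W) -> seq W -> W.
Variable act : (seq W -> W) -> seq W -> W.

Definition tilde_sort : lmodType k := ((seq W -> W) * W)%type.

Definition tilde : homData k :=
  @HomData k tilde_sort
    (fun b x => mem (~~ b) x.1 /\ hom W b x.2)
    (fun b x => (- (der_dif (~~ b) x.1 : seq W -> W), dif W x.2)).

(* m_2(Pi g, Pi h) = (-1)^|g| Pi [g, h] *)
Definition tilde_bracket (s : seq (bool * tilde)) : seq W -> W :=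
  if s is [:: (p, x); (q, y)] then
    (-1) ^+ (~~ p) *: (br (~~ p) (~~ q) x.1 y.1 : seq W -> W)
  else 0.

(* m_n(Pi g, w_1, ..., w_(n-1)) = g(w_1, ..., w_(n-1)), extended by symmetry:
   in the r-th term Pi g comes from the r-th argument, which is first moved to
   the front. *)
Definition tilde_act (s : seq (bool * tilde)) : W :=
  if (size s <= 1)%N then 0 else
  \sum_(r < size s)
    let x := tnth (in_tuple s) r in
    (-1) ^+ (x.1 && par (unzip1 (take r s))) *:
      act x.2.1 [seq p.2.2 | p <- take r s ++ drop r.+1 s].

Definition tilde_op (s : seq (bool * tilde)) : tilde :=
  (tilde_bracket s, tilde_act s).

(* An element of A (x) Pi (g + V) as g + xi, where, by parity shift,
   Pi (e_a (x) g_a) = (-1)^|a| e_a (x) Pi g_a, and where g is identified with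
   the collection of maps s |-> sum_a e_a (x) g_a(s). *)
Definition tilde_split (A : formal_cdga k) (x : tens A tilde) :
    (seq W -> tens A W) * tens A W :=
  (fun s i a => (-1) ^+ upar a *: (x i a).1 s, fun i a => (x i a).2).
End Tilde.

Section TildeAlgebras.
Variables (k : fieldType) (A : formal_cdga k) (V : dgSpace k).

Definition MC_tilde_c : set (tens A (tilde (@in_c k (Pi V)))) :=
  MC_Linfty (const_op (@tilde_op k (Pi V) (@in_c k (Pi V))
                           (@bracket_c k (Pi V)) id)).

Definition MC_tilde_a : set (tens A (tilde (@in_a k (Pi V)))) :=
  MC_Linfty (const_op (@tilde_op k (Pi V) (@in_a k (Pi V))
                           (@bracket_a k (Pi V)) (@symmetrize k (Pi V)))).

Definition MC_tilde_cs (B : scalarProduct V) :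
    set (tens A (tilde (@in_cs k (Pi V) (omega B)))) :=
  MC_Linfty (const_op (@tilde_op k (Pi V) (in_cs (omega B))
                           (@bracket_c k (Pi V)) id)).

Definition MC_tilde_as (B : scalarProduct V) :
    set (tens A (tilde (@in_as k (Pi V) (omega B)))) :=
  MC_Linfty (const_op (@tilde_op k (Pi V) (in_as (omega B))
                           (@bracket_a k (Pi V)) (@symmetrize k (Pi V)))).

Definition MC_L (m : seq (Pi V) -> tens A (Pi V)) : set (tens A (Pi V)) :=
  @MC_Linfty k A (dg_homData (Pi V)) (untagged m).

Definition MC_A (m : seq (Pi V) -> tens A (Pi V)) : set (tens A (Pi V)) :=
  @MC_Ainfty k A (dg_homData (Pi V)) (untagged m).
End TildeAlgebras.

(* Main.v *)
From HB Require Import structures.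
From mathcomp Require Import all_boot all_order all_fingroup all_algebra.
From mathcomp Require Import boolp classical_sets functions.
From mathcomp Require Import ring.
Require Import Defs.
Set Implicit Arguments.
Unset Strict Implicit.
Unset Printing Implicit Defensive.
Import GRing.Theory.
Local Open Scope ring_scope.

(* An element of A (x) Pi(g + V) is a pair (g, xi), and its Maurer-Cartan equation
   splits along g and V.  The g-component only involves the differential and the
   binary product; with m_a = (-1)^|a| g_a it is, up to the sign -(-1)^|c|, the
   equation d(m) + (1/2)[m, m] = 0, in which [m, m] = 2 m o m by graded
   commutativity of A.  In the V-component the n + 1 positions of Pi g in the
   (n+1)-ary product contribute equally, again by graded commutativity, so that
   1/(n+1)! becomes 1/n!, the coefficient for an L-infinity structure; for
   A-infinity structures the n! terms of the symmetrization also agree on xi^n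
   and turn it into 1.  Partial sums up to N + 1 thus match partial sums up to N
   and no convergence argument is needed. *)

(** * The unitization of a nilpotent algebra *)

Section BasisCoord.
Variables (k : fieldType) (A : nilcdga k).
Implicit Types (x y : A) (j l : hbasis A).

Lemma bvec_hom j : hom (nc_str A) (tag j) (bvec j).
Proof.
have /memv_imgP[u _ ->] : bvec j \in hpart A (tag j).
  by apply: vbasis_mem; rewrite /bvec mem_nth // size_tuple.
by rewrite /hom lfunE /= gpr_gpr eqxx.
Qed.

Lemma bcoord_sum x : x = \sum_j bcoord x j *: bvec j.
Proof.
transitivity (\sum_b \sum_i
    coord (vbasis (hpart A b)) i (gpr (nc_str A) b x) *: (vbasis (hpart A b))`_i).
  under eq_bigr => b _.
    rewrite -coord_vbasis; first by over.
    by apply/memv_imgP; exists x; rewrite ?memvf // lfunE.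
  by rewrite big_bool /= addrC gpr_sum.
by rewrite sig_big_dep.
Qed.

Lemma bcoordZ a x j : bcoord (a *: x) j = a * bcoord x j.
Proof. by rewrite /bcoord !linearZ. Qed.

Lemma bcoord_parity b x j :
  hom (nc_str A) b x -> b != tag j -> bcoord x j = 0.
Proof.
by move=> <-; rewrite /bcoord gpr_gpr eq_sym => /negPf ->; rewrite linear0.
Qed.

Lemma nc_mulZl a x y : nc_mul (a *: x) y = a *: nc_mul x y.
Proof.
have := nc_mulDl 0 0 0 y; rewrite !scale0r !add0r => z.
have := nc_mulDl a x 0 y; rewrite !addr0 => ->.
have := nc_mulDl (-1) 0 0 y; rewrite scaler0 addr0 scaleN1r addNr => ->.
by rewrite addr0.
Qed.

Lemma nc_mulr_linear x : linear (nc_mul x).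
Proof. by move=> a y z; rewrite nc_mulDr. Qed.

HB.instance Definition _ x :=
  GRing.isLinear.Build k A A _ (nc_mul x) (nc_mulr_linear x).

End BasisCoord.

Lemma sum_option (V : nmodType) (T : finType) (F : option T -> V) :
  \sum_d F d = F None + \sum_j F (Some j).
Proof.
rewrite (bigD1 None) //=; congr (_ + _).
rewrite (reindex_omap Some id) /=; last by case.
by apply: eq_bigl => j; rewrite eqxx.
Qed.

Section Unitization.
Variables (k : fieldType) (A : nilcdga k).
Implicit Types (a b c : ubasis A).

Lemma umul1 a c : umul a None c = (a == c)%:R.
Proof. by case: a. Qed.

Lemma umulC a b c : umul a b c = (-1) ^+ (upar a && upar b) * umul b a c.
Proof.
case: a b c => [i|] [j|] [l|] //=; rewrite ?andbF ?mul1r ?mulr0 //.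
by rewrite (nc_mulC (bvec_hom i) (bvec_hom j)) bcoordZ.
Qed.

Lemma umul_parity a b c : upar c != upar a (+) upar b -> umul a b c = 0.
Proof.
case: a b c => [i|] [j|] [l|] //=; rewrite ?addbF.
- move=> ne; apply: bcoord_parity (nc_mul_hom (bvec_hom i) (bvec_hom j)) _.
  by rewrite eq_sym.
- by move=> ne; case: eqP => // -[e]; rewrite e eqxx in ne.
- by move=> ne; case: eqP => // -[e]; rewrite e eqxx in ne.
Qed.

Lemma udif_parity b c : upar c != ~~ upar b -> udif b c = 0.
Proof.
case: b c => [j|] [l|] //= ne.
apply: (@bcoord_parity _ _ (~~ tag j)); last by rewrite eq_sym.
by rewrite /hom -dif_gpr bvec_hom.
Qed.

(** Coordinate form of e_a (e_b e_e) = (-1)^(|a||b|) e_b (e_a e_e), from associativity and graded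
    commutativity. Units are treated apart because [umul] is defined by cases. *)
Lemma umul_comm a b e c :
  \sum_d umul a d c * umul b e d =
  (-1) ^+ (upar a && upar b) * \sum_d umul b d c * umul a e d.
Proof.
have sumL a' b' : umul a' b' c = \sum_d (b' == d)%:R * umul a' d c.
  rewrite (bigD1 b') //= eqxx mul1r big1 ?addr0 // => d ne.
  by rewrite eq_sym (negPf ne) mul0r.
have sumR a' b' : \sum_d (d == c)%:R * umul a' b' d = umul a' b' c.
  by rewrite (bigD1 c) //= eqxx mul1r big1 ?addr0 // => d /negPf ->; rewrite mul0r.
case: a => [i|]; last first.
  rewrite mul1r [LHS]sumR [LHS]sumL.
  by apply: eq_bigr => d _; rewrite mulrC.
case: b => [j|]; last first.
  rewrite andbF mul1r [RHS]sumR [RHS]sumL.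
  by apply: eq_bigr => d _; rewrite mulrC.
case: e => [l|]; last first.
  under eq_bigr do rewrite umul1 mulrC.
  under [in RHS]eq_bigr do rewrite umul1 mulrC.
  by rewrite -!sumL umulC.
(* A product of vectors of the nilpotent algebra has no coordinate along the unit, so both sides
   vanish. *)
case: c {sumL sumR} => [c|]; last first.
  rewrite !big1 ?mulr0 // => -[d|] _ /=; rewrite ?mul0r //.
have ass i' j' : \sum_d umul (Some i') d (Some c) * umul (Some j') (Some l) d
    = bcoord (nc_mul (bvec i') (nc_mul (bvec j') (bvec l))) c.
  rewrite sum_option /= mulr0 add0r.
  rewrite [X in nc_mul (bvec i') X]bcoord_sum linear_sum /bcoord !linear_sum /=.
  by apply: eq_bigr => d _; rewrite !linearZ /= mulrC.
rewrite !ass !nc_mulA (nc_mulC (bvec_hom i) (bvec_hom j)).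
by rewrite nc_mulZl bcoordZ.
Qed.
End Unitization.

Lemma utr_parity (k : fieldType) (A B : nilcdga k) (f : {linear B -> A})
  (b : ubasis B) (c : ubasis A) :
  (forall p x, f (gpr (nc_str B) p x) = gpr (nc_str A) p (f x)) ->
  upar c != upar b -> utr f b c = 0.
Proof.
move=> fgpr; case: b c => [j|] [l|] //= ne.
apply: (@bcoord_parity _ _ (tag j)); last by rewrite eq_sym.
by rewrite /hom -fgpr bvec_hom.
Qed.

(** * Multilinear extension of operations *)

Section TupleSums.
Variables (V : nmodType) (T : finType).

Lemma sum_tuple0 (F : seq T -> V) : \sum_(a : 0.-tuple T) F a = F [::].
Proof.
by rewrite (bigD1 [tuple]) //= big1 ?addr0 // => a /eqP[]; apply: tuple0.
Qed.

Lemma sum_tupleS n (F : seq T -> V) :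
  \sum_(a : n.+1.-tuple T) F a = \sum_x \sum_(a : n.-tuple T) F (x :: a).
Proof.
rewrite pair_big /=.
rewrite (reindex (fun p : T * n.-tuple T => [tuple of p.1 :: p.2])) //=.
exists (fun a : n.+1.-tuple T => (thead a, [tuple of behead a])) => [[x a] _|a _].
  by congr (_, _); apply: val_inj.
by rewrite /= -tuple_eta.
Qed.

(** Isolates the entry at position [r], which will be the slot held by Pi g in the action
    products. *)
Lemma sum_tuple_insert r n (F : seq T -> V) : (r <= n)%N ->
  \sum_(a : n.+1.-tuple T) F a =
  \sum_x \sum_(a : n.-tuple T) F (take r a ++ x :: drop r a).
Proof.
elim: r n F => [|r IHr] n F; first by rewrite sum_tupleS; under [in RHS]eq_bigr
  do under eq_bigr do rewrite take0 drop0.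
case: n => // n le_rn; rewrite sum_tupleS.
under eq_bigr => y _ do rewrite (IHr n (fun s => F (y :: s)) le_rn).
rewrite exchange_big /=; apply: eq_bigr => x _.
by rewrite (sum_tupleS n (fun a => F (take r.+1 a ++ x :: drop r.+1 a))).
Qed.

Lemma sum_tuple_perm n (s : 'S_n) (F : n.-tuple T -> V) :
  \sum_a F [tuple tnth a (s i) | i < n] = \sum_a F a.
Proof.
rewrite [RHS](reindex (fun a : n.-tuple T => [tuple tnth a (s i) | i < n])) //.
exists (fun a : n.-tuple T => [tuple tnth a ((s^-1)%g i) | i < n]) => a _;
  by apply: eq_from_tnth => i; rewrite !tnth_mktuple ?permK ?permKV.
Qed.
End TupleSums.

(** * Left multiplications and their Koszul signs *)

Section Operators.
Variables (k : fieldType) (A : nilcdga k) (X : lmodType k).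
Implicit Types (a b c : ubasis A) (s : seq (ubasis A)) (v : ubasis A -> X).

Definition smul a v : ubasis A -> X := fun c => \sum_b umul a b c *: v b.

Lemma smul_linear a : linear (smul a).
Proof.
move=> z u v; apply/funext => c; rewrite /smul /=.
under eq_bigr do rewrite scalerDr scalerA mulrC -scalerA.
by rewrite big_split /= -scaler_sumr.
Qed.

HB.instance Definition _ a :=
  GRing.isLinear.Build k (ubasis A -> X) (ubasis A -> X) _ (smul a)
    (smul_linear a).

Lemma smul1 v : smul None v = v.
Proof.
apply/funext => c; rewrite /smul (bigD1 c) //= eqxx scale1r big1 ?addr0 //.
by move=> b /negPf ->; rewrite scale0r.
Qed.

Lemma unit_tens_linear : linear (@unit_tens k A X).
Proof.
move=> z u v; apply/funext => -[c|].
  by rewrite addrfctE scalrfctE /= scaler0 addr0.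
by rewrite addrfctE scalrfctE.
Qed.

HB.instance Definition _ :=
  GRing.isLinear.Build k X (ubasis A -> X) _ (@unit_tens k A X) unit_tens_linear.

Lemma smul_unit a (u : X) :
  smul a (@unit_tens k A X u) = fun c => (a == c)%:R *: u.
Proof.
apply/funext => c; rewrite /smul (bigD1 None) //= umul1 big1 ?addr0 //.
by case=> // b _; rewrite scaler0.
Qed.

Lemma unit_decomp v : v = \sum_a smul a (@unit_tens k A X (v a)).
Proof.
apply/funext => c; rewrite fct_sumE (bigD1 c) //= smul_unit eqxx scale1r.
by rewrite big1 ?addr0 // => b /negPf ne; rewrite smul_unit ne scale0r.
Qed.

Lemma smul_comm a b v :
  smul a (smul b v) = (-1) ^+ (upar a && upar b) *: smul b (smul a v).
Proof.
have sumE a' b' c : smul a' (smul b' v) c =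
    \sum_e (\sum_d umul a' d c * umul b' e d) *: v e.
  rewrite /smul; under eq_bigr do rewrite scaler_sumr.
  rewrite exchange_big; apply: eq_bigr => e _; rewrite scaler_suml.
  by apply: eq_bigr => d _; rewrite scalerA.
apply/funext => c; rewrite [RHS]/GRing.scale /= !sumE scaler_sumr.
by apply: eq_bigr => e _; rewrite scalerA umul_comm.
Qed.

Definition upars s : bool := par (map (@upar k A) s).

(* The operator v |-> m (e_(a_1) (x) u_1, ..., e_(a_n) (x) u_n) for m of parity
   [q] and v = m (u_1, ..., u_n): Koszul signs and left multiplications. *)
Fixpoint kmul (q : bool) s v : ubasis A -> X :=
  if s is a :: s' then
    (-1) ^+ (q && upar a) *: smul a (kmul (q (+) upar a) s' v)
  else v.

Lemma kmul_linear q s : linear (kmul q s).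
Proof.
elim: s q => [|a s IHs] q z u v //=.
by rewrite IHs linearP scalerDr !scalerA mulrC.
Qed.

HB.instance Definition _ q s :=
  GRing.isLinear.Build k (ubasis A -> X) (ubasis A -> X) _ (kmul q s)
    (kmul_linear q s).

Lemma kmul_cons q a s v :
  kmul q (a :: s) v = (-1) ^+ (q && upar a) *: smul a (kmul (q (+) upar a) s v).
Proof. by []. Qed.

(** Pulling e_a out past each e_b of [s] yields the sign (-1)^(|a||b|), which is what shifting the
    parity of the operation by |a| accounts for. *)
Lemma kmul_smul q s a v :
  kmul q s (smul a v) = smul a (kmul (q (+) upar a) s v).
Proof.
elim: s q => [|b s IHs] q //=; rewrite IHs smul_comm !linearZ /= scalerA.
rewrite -signr_addb (addbAC q); congr ((-1) ^+ (nat_of_bool _) *: _).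
by case: q (upar a) (upar b) => [] [] [].
Qed.

(** Induction on [s1], exchanging e_a with one neighbour at a time by [smul_comm]; the signs due to
    the operation crossing e_a and e_b do not depend on their order. *)
Lemma kmul_move q a s1 s2 v : kmul q (a :: s1 ++ s2) v =
  (-1) ^+ (upar a && upars s1) *: kmul q (s1 ++ a :: s2) v.
Proof.
elim: s1 q => [|b s1 IHs] q; first by rewrite /upars andbF scale1r.
rewrite cat_cons !kmul_cons (addbAC q) -[upars (b :: s1)]/(upar b (+) upars s1).
rewrite !linearZ /= smul_comm !scalerA.
have := IHs (q (+) upar b); rewrite kmul_cons => /(congr1 (smul b)).
rewrite !linearZ /= => IHb.
have -> : smul b (smul a (kmul (q (+) upar b (+) upar a) (s1 ++ s2) v)) =
  (-1) ^+ ((q (+) upar b) && upar a) *: ((-1) ^+ (upar a && upars s1) *: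
    smul b (kmul (q (+) upar b) (s1 ++ a :: s2) v)).
  by rewrite -IHb scalerA -signr_addb addbb scale1r.
rewrite !scalerA -!signr_addb; congr ((-1) ^+ (nat_of_bool _) *: _).
clear; by case: q (upar a) (upar b) (upars s1) => [] [] [] [].
Qed.
End Operators.

Section Ext.
Variables (k : fieldType) (A : nilcdga k) (U : homData k).

Lemma tens_scaleE a (t : ubasis A -> U) : tens_scale a t = smul a t.
Proof. by []. Qed.

(** As the repeated tensor is even, its coordinate along e_a is listed with parity |a|, so the
    parity of the operation evolves as in [kmul]. *)
Lemma ext_nseq q (m : seq (bool * U) -> ubasis A -> U) n t :
  ext q m (nseq n (false, t)) =
  \sum_(s : n.-tuple (ubasis A)) kmul q s (m [seq (upar a, t a) | a <- s]).
Proof.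
elim: n q m => [|n IHn] q m.
  by rewrite (sum_tuple0 (fun s => kmul q s (m [seq (upar a, t a) | a <- s]))).
rewrite (sum_tupleS n (fun s => kmul q s (m [seq (upar a, t a) | a <- s]))) /=.
apply/funext => c; rewrite fct_sumE; apply: eq_bigr => a _ /=.
rewrite tens_scaleE addbF (IHn _ (fun s => m ((upar a, t a) :: s))).
rewrite (linear_sum (smul a)) fct_sumE scaler_sumr fct_sumE; exact: eq_bigr.
Qed.

(** Only the unit coordinate of 1 (x) u can be nonzero, so these arguments enter unscaled and merely
    add their parities to that of the operation; the hypothesis kills the other terms. *)
Lemma ext_units q (m : seq (bool * U) -> ubasis A -> U) s ts :
  (forall s1 p s2, m (s1 ++ (p, 0) :: s2) = 0) ->
  ext q m ([seq (p.1, unit_tens p.2) | p <- s] ++ ts) =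
  ext (q (+) par (unzip1 s)) (fun s' => m (s ++ s')) ts.
Proof.
elim: s q m => [|[p u] s IHs] q m m0; first by rewrite addbF.
apply/funext => c /=; rewrite (bigD1 None) //= big1 ?addr0.
  rewrite andbF scale1r !addbF tens_scaleE smul1.
  rewrite IHs ?addbA // => s1 r s2; exact: (m0 ((p, u) :: s1)).
case=> // j _ /=.
have ext0 q' (m' : seq (bool * U) -> ubasis A -> U) ts' :
    (forall s', m' s' = 0) -> ext q' m' ts' = 0.
  elim: ts' q' m' => [|[p' t'] ts' IH] q' m' m'0; apply/funext => c' /=.
    by rewrite m'0.
  by rewrite big1 // => a _; rewrite IH // tens_scaleE linear0 scaler0.
rewrite ext0 => [|s']; last exact: (m0 [::]).
by rewrite tens_scaleE linear0 scaler0.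
Qed.
End Ext.

(** * Koszul signs of permutations *)

Section InversionSign.
Variable e : nat -> bool.

Definition inversions n (s : 'S_n) : nat :=
  #|[set ij : 'I_n * 'I_n |
      [&& (ij.1 < ij.2)%N, (s ij.2 < s ij.1)%N, e (s ij.1) & e (s ij.2)]]|.

(** The inversion count for a list of values, in the recursive form that insertion sort follows. *)
Fixpoint seq_inversions (l : seq nat) : nat :=
  if l is x :: l' then
    (e x * count (fun y => (y < x)%N && e y) l' + seq_inversions l')%N
  else 0.

Lemma seq_inversionsE (l : seq nat) :
  seq_inversions l = (\sum_(i < size l) \sum_(j < size l)
    [&& i < j, nth 0 l j < nth 0 l i, e (nth 0 l i) & e (nth 0 l j)])%N.
Proof.
elim: l => [|x l IHl]; first by rewrite big_ord0.
rewrite big_ord_recl big_ord_recl /= add0n IHl; congr (_ + _)%N.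
  rewrite -sum1_count big_mkcond (big_nth 0%N) big_mkord big_distrr /=.
  by apply: eq_bigr => j _; case: (_ < _)%N; case: (e x); case: (e _).
by apply: eq_bigr => i _; rewrite big_ord_recl add0n.
Qed.

Lemma inversionsE n (s : 'S_n) :
  inversions s = seq_inversions [seq val (s i) | i <- enum 'I_n].
Proof.
rewrite seq_inversionsE size_map size_enum_ord pair_bigA /= /inversions -sum1dep_card.
rewrite big_mkcond; apply: eq_bigr => -[i j] _ /=.
have nthE (r : 'I_n) : nth 0%N [seq val (s i) | i <- enum 'I_n] r = s r.
  by rewrite (nth_map r) ?size_enum_ord // nth_ord_enum.
by rewrite !nthE; case: ifP.
Qed.
End InversionSign.

Section KmulPerm.
Variables (k : fieldType) (A : nilcdga k) (X : lmodType k).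
Variables (a : seq (ubasis A)) (v : ubasis A -> X).
Let f i := nth None a i.
Let e i := upar (f i).

Lemma uparsE (l : seq nat) : upars (map f l) = odd (count e l).
Proof.
by rewrite /upars; elim: l => //= x l ->; rewrite oddD oddb.
Qed.

(** Locates the place where insertion sort puts [x]. *)
Lemma pairwise_ltn_split x l : pairwise ltn l -> x \notin l ->
  [seq y <- l | (y < x)%N] ++ [seq y <- l | (x < y)%N] = l.
Proof.
elim: l => //= y l IHl /andP[y_l sl]; rewrite inE => /norP[nexy xl].
case: (ltngtP y x) nexy => // [lt_yx | lt_xy] _ /=; first by rewrite IHl.
have -> : [seq y <- l | (y < x)%N] = [::].
  apply/eqP; rewrite -(negbK (_ == _)) -has_filter; apply/hasPn => z zl.
  by rewrite -leqNgt; apply: ltnW; apply: ltn_trans lt_xy (allP y_l _ zl).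
congr (_ :: _); apply/all_filterP/allP => z zl.
by apply: ltn_trans lt_xy (allP y_l _ zl).
Qed.

(* Insertion sort: the sign is that of moving e_x past the smaller elements. *)
Lemma kmul_sort (l : seq nat) : uniq l -> exists l', [/\ pairwise ltn l',
    perm_eq l l' & forall q, kmul q (map f l) v =
      (-1) ^+ seq_inversions e l *: kmul q (map f l') v].
Proof.
elim: l => [|x l IHl]; first by exists [::]; split=> // q; rewrite scale1r.
case/andP=> xl /IHl[l' [sl' pl kl]].
have xl' : x \notin l' by rewrite -(perm_mem pl).
have El' := pairwise_ltn_split sl' xl'.
set s1 := filter _ l' in El'; set s2 := filter _ l' in El'.
exists (s1 ++ x :: s2); split.
- rewrite pairwise_cat /= !pairwise_filter // !andbT.
  have all2 : all (ltn x) s2 by apply: filter_all.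
  rewrite all2 andbT allrel_consr andbT; apply/andP; split.
    exact: filter_all.
  apply/allrelP => y z; rewrite !mem_filter => /andP[yx _] /andP[xz _].
  exact: ltn_trans yx xz.
- by rewrite perm_sym (perm_catCA s1 [:: x] s2) /= El' perm_cons perm_sym.
- move=> q; rewrite map_cons kmul_cons kl linearZ scalerA mulrC -scalerA -kmul_cons.
  rewrite -{1}El' map_cat kmul_move scalerA map_cat uparsE exprD mulrC.
  congr (_ * _ *: _); rewrite (seq.permP pl) /= -[in RHS]signr_odd oddM oddb.
  congr (_ ^+ (nat_of_bool (_ && odd _))).
  by rewrite /s1 count_filter; apply: eq_count => y; rewrite /= andbC.
Qed.

Lemma kmul_perm n (q : bool) (s : 'S_n) : size a = n -> kmul q a v =
  (-1) ^+ odd (inversions e s) *: kmul q [seq f (s i) | i <- enum 'I_n] v.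
Proof.
move=> sa; rewrite inversionsE signr_odd.
have ul : uniq [seq val (s i) | i <- enum 'I_n].
  by rewrite map_inj_uniq ?enum_uniq // => i j /val_inj /perm_inj.
have [l' [sl' pl kl]] := kmul_sort ul.
(* A strictly increasing list is determined by its elements; those of [l'] are the numbers below
   [n], so [l'] is [iota 0 n]. *)
have {1}-> : a = map f l'.
  rewrite -[LHS](mkseq_nth None) /mkseq; congr (map _ _).
  apply: (@irr_sorted_eq _ ltn ltn_trans ltnn _ _ (iota_ltn_sorted _ _)).
    exact: pairwise_sorted.
  move=> i; rewrite -(perm_mem pl) mem_iota add0n sa /=.
  apply/idP/mapP => [lt_i | [j _ ->] //].
  by exists ((s^-1)%g (Ordinal lt_i)); rewrite ?mem_enum // permKV.
have := kl q; rewrite -map_comp => ->.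
(* The sign of the sorting occurs twice and squares to one. *)
by rewrite scalerA -exprD addnn -signr_odd odd_double scale1r.
Qed.
End KmulPerm.

(** * Multilinear maps and their compositions *)

Section Multilinear.
Variables (k : fieldType) (W : dgSpace k).

Section OneMap.
Variables (X : lmodType k) (f : seq W -> X).
Hypothesis fM : multilin f.

Lemma multilinD s t x y : f (s ++ (x + y) :: t) = f (s ++ x :: t) + f (s ++ y :: t).
Proof. by rewrite -[x]scale1r fM.2 !scale1r. Qed.

Lemma multilin_at0 s t : f (s ++ 0 :: t) = 0.
Proof. by apply: (addrI (f (s ++ 0 :: t))); rewrite -multilinD !addr0. Qed.

Lemma multilinZ a s t x : f (s ++ a *: x :: t) = a *: f (s ++ x :: t).
Proof. by rewrite -[a *: x]addr0 fM.2 multilin_at0 addr0. Qed.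

Lemma multilin0 s : 0 \in s -> f s = 0.
Proof. by case/splitPr => s1 s2; apply: multilin_at0. Qed.
End OneMap.

Lemma multilin_scale (X : lmodType k) a (f : seq W -> X) :
  multilin f -> multilin (a *: f).
Proof.
move=> fM; have E s : (a *: f) s = a *: f s by [].
by split=> [|s t b x y]; rewrite !E ?fM.1 ?scaler0 // fM.2 scalerDr !scalerA mulrC.
Qed.

Definition grade (e : seq bool) (s : seq W) : seq (bool * W) :=
  [seq (p.1, gpr W p.1 p.2) | p <- zip e s].

Lemma homs_cons p (s : seq (bool * W)) : @homs k (dg_homData W) (p :: s) <->
  hom W p.1 p.2 /\ @homs k (dg_homData W) s.
Proof.
split=> [hs|[hp hs] r]; last by rewrite inE => /orP[/eqP->|/hs].
by split=> [|r rs]; apply: hs; rewrite inE ?eqxx ?rs ?orbT.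
Qed.

Lemma homs_grade e s : @homs k (dg_homData W) (grade e s).
Proof.
move=> p /mapP[[b x] _ ->] /=; rewrite /hom gpr_gpr eqxx //.
Qed.

Lemma grade_unzip (s : seq (bool * W)) : @homs k (dg_homData W) s ->
  grade (unzip1 s) (unzip2 s) = s.
Proof.
elim: s => //= -[b x] s IHs /homs_cons[/= hx /IHs Es].
by rewrite /grade /= hx -/(grade _ _) Es.
Qed.

Lemma grade_neq e (s : seq (bool * W)) : @homs k (dg_homData W) s ->
  size e = size s -> e != unzip1 s -> 0 \in unzip2 (grade e (unzip2 s)).
Proof.
elim: s e => [|[b x] s IHs] [|c e] //= /homs_cons[/= hx hs] [es].
rewrite eqseq_cons negb_and inE -hx gpr_gpr => /orP[/negPf->|ne].
  by rewrite eqxx.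
by rewrite IHs ?orbT.
Qed.

Section FromHoms.
Variables (X : lmodType k) (F : seq (bool * W) -> X).
Hypothesis F0 : forall s, 0 \in unzip2 s -> F s = 0.

(** At any other choice of parities some projection annihilates its argument, so only the summand at
    the actual parities survives. *)
Lemma from_homs_hom (s : seq (bool * W)) : @homs k (dg_homData W) s ->
  from_homs F (unzip2 s) = F s.
Proof.
move=> hs; rewrite /from_homs.
have s1 : size (unzip1 s) == size (unzip2 s) by rewrite !size_map.
rewrite (bigD1 (Tuple s1)) //= -/(grade (unzip1 s) _) grade_unzip // big1.
  by rewrite addr0.
by move=> e ne; apply/F0/grade_neq => //; rewrite size_tuple size_map.
Qed.

Lemma from_homs_grade s : from_homs F s =
  \sum_(e : (size s).-tuple bool) from_homs F (unzip2 (grade e s)).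
Proof.
by apply: eq_bigr => e _; rewrite from_homs_hom //; apply: homs_grade.
Qed.
End FromHoms.

(** Lets identities between functions additive in each argument be checked on homogeneous
    arguments. *)
Lemma additive_grade (X : lmodType k) (f : seq W -> X) s :
  (forall s1 s2 x y, f (s1 ++ (x + y) :: s2) = f (s1 ++ x :: s2) + f (s1 ++ y :: s2)) ->
  f s = \sum_(e : (size s).-tuple bool) f (unzip2 (grade e s)).
Proof.
(* The induction carries a prefix of arguments already split, since additivity is applied in the
   middle of the list. *)
move=> fD; rewrite -{1}[s]cat0s.
have -> : \sum_(e : (size s).-tuple bool) f (unzip2 (grade e s)) =
  \sum_(e : (size s).-tuple bool) f ([::] ++ unzip2 (grade e s)) by [].
elim: s [::] => [|x s IHs] s1 /=.
  by rewrite (sum_tuple0 (fun e => f (s1 ++ unzip2 (grade e [::])))) cats0.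
rewrite (sum_tupleS _ (fun e => f (s1 ++ unzip2 (grade e (x :: s))))) /=.
have cons_grade b : \sum_(e : (size s).-tuple bool)
    f (s1 ++ unzip2 (grade (b :: e) (x :: s))) = f (s1 ++ gpr W b x :: s).
  by rewrite -cat_rcons IHs; apply: eq_bigr => e _; rewrite cat_rcons.
by rewrite big_bool /= !cons_grade addrC -fD gpr_sum.
Qed.

(** A cut at [i] falls before or after the marked slot independently of what the slot holds, which
    is what additivity in the slot requires. *)
Lemma split_around T i (s1 s2 : seq T) :
  (exists a b, forall z, take i (s1 ++ z :: s2) = a /\
    drop i (s1 ++ z :: s2) = b ++ z :: s2) \/
  (exists a b, forall z, take i (s1 ++ z :: s2) = s1 ++ z :: a /\
    drop i (s1 ++ z :: s2) = b).
Proof.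
case: (ltnP (size s1) i) => [lt|le].
  right; exists (take (i - (size s1).+1) s2), (drop (i - (size s1).+1) s2) => z.
  by rewrite take_cat drop_cat ltnNge (ltnW lt) /= -(subnSK lt).
left; exists (take i s1), (drop i s1) => z.
move: le; rewrite leq_eqVlt take_cat drop_cat => /predU1P[->|->] //.
by rewrite ltnn subnn take0 drop0 cats0 take_size drop_size.
Qed.

(** The slot lies after the block fed to [h], inside it, or before it, where it meets the additive
    twist [tau q]. *)
Lemma comp_insert_additive q (g h : seq W -> W) : multilin g -> multilin h ->
  forall s1 s2 x y, comp_insert q g h (s1 ++ (x + y) :: s2) =
    comp_insert q g h (s1 ++ x :: s2) + comp_insert q g h (s1 ++ y :: s2).
Proof.
move=> gM hM s1 s2 x y.
have sz z : size (s1 ++ z :: s2) = (size s1 + (size s2).+1)%N by rewrite size_cat.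
rewrite /comp_insert !sz -big_split; apply: eq_bigr => i _.
rewrite -big_split; apply: eq_bigr => l _ /=.
rewrite [(i + _)%N]addnC -!drop_drop.
have tD z w : tau q (z + w) = tau q z + tau q w :> W.
  by rewrite /tau !linearD /= addrACA.
case: (split_around i s1 s2) => [[a [b ab]] | [a [b ab]]].
  have E z := ab z; rewrite !(ab _).1 !(ab _).2.
  case: (split_around l.+1 b s2) => [[a' [b' ab']] | [a' [b' ab']]].
    by rewrite !(ab' _).1 !(ab' _).2 -!cat_cons !catA multilinD.
  by rewrite !(ab' _).1 !(ab' _).2 multilinD // multilinD.
by rewrite !(ab _).1 !(ab _).2 !map_cat /= tD -!catA !cat_cons multilinD.
Qed.

(** Presents the inner part of [d, g] as the insertion of a unary map, so that additivity of
    insertions covers it; only blocks of length one survive. *)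
Lemma insert_difE (g : seq W -> W) s : multilin g ->
  insert_dif g s =
  comp_insert true g (fun t => if t is [:: x] then dif W x else 0) s.
Proof.
move=> gM; apply: eq_bigr => i _.
have lt_i : (0 < size s - i)%N by rewrite subn_gt0.
rewrite (bigD1 (Ordinal lt_i)) //= [in take 1 _](drop_nth 0) //= take0 addn1.
rewrite big1 ?addr0 //.
move=> l nel; have : size (take l.+1 (drop i s)) = l.+1.
  by rewrite size_takel // size_drop.
case: (take _ _) => [|z [|w t]] //= [El]; last by rewrite multilin_at0.
by case/eqP: nel; apply: val_inj.
Qed.

Lemma multilin_dif : multilin (fun t : seq W => if t is [:: x] then dif W x else 0).
Proof.
by split=> // -[|z s] [|w t] a x y //=; rewrite ?linearP ?scaler0 ?addr0 //;
  case: s => [|? s] /=; rewrite ?scaler0 ?addr0.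
Qed.
End Multilinear.

(** * Symmetrization on repeated arguments *)

Section Symmetrization.
Variables (k : fieldType) (A : nilcdga k) (W : dgSpace k).

(** Moves the sum to a fixed ['S_n], so that one permutation acts on all tuples of basis vectors of
    length [n]. *)
Lemma sum_permute (X : lmodType k) d n (s : seq (bool * W)) (g : seq W -> X) :
  size s = n ->
  \sum_(r : 'S_(size s)) (-1) ^+ perm_sign r *: g (unzip2 (permute r)) =
  \sum_(r : 'S_n) (-1) ^+ odd (inversions (fun i => (nth d s i).1) r) *:
    g [seq (nth d s (r i)).2 | i <- enum 'I_n].
Proof.
case: n /; apply: eq_bigr => r _; congr (_ ^+ (nat_of_bool (odd _)) *: g _).
  by apply: eq_card => -[i j]; rewrite !inE !(tnth_nth d).
by rewrite /unzip2 -map_comp; apply: eq_map => i /=; rewrite (tnth_nth d).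
Qed.

(** Since w_a has parity |a|, the Koszul sign of permuting the vectors cancels that of permuting the
    e_a; reindexing the tuples then makes all n! terms equal. *)
Lemma sum_symmetrize (g : seq W -> W) (w : ubasis A -> W) q n :
  multilin g -> (forall a, hom W (upar a) (w a)) ->
  \sum_(a : n.-tuple (ubasis A)) kmul q a (unit_tens (symmetrize g (map w a))) =
  n`!%:R *: \sum_(a : n.-tuple (ubasis A)) kmul q a (unit_tens (g (map w a))).
Proof.
move=> gM w_hom.
pose G (r : 'S_n) (a : n.-tuple (ubasis A)) := [tuple tnth a (r i) | i < n].
have symE (a : n.-tuple (ubasis A)) : symmetrize g (map w a) =
    \sum_(r : 'S_n) (-1) ^+ odd (inversions (fun i => upar (nth None a i)) r) *:
      g (map w (G r a)).
  have -> : map w a = unzip2 [seq (upar x, w x) | x <- a].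
    by rewrite /unzip2 -map_comp.
  rewrite /symmetrize from_homs_hom.
  - rewrite (@sum_permute _ (false, 0) n) ?size_map ?size_tuple //.
    apply: eq_bigr => r _; congr (_ ^+ (nat_of_bool (odd _)) *: g _).
      apply: eq_card => -[i j]; rewrite !inE.
      by rewrite !(nth_map None) ?size_tuple.
    rewrite /G /= -map_comp; apply: eq_map => i /=.
    by rewrite (nth_map None) ?size_tuple // (tnth_nth None).
  - move=> s /mapP[p ps p0]; rewrite big1 // => r _.
    rewrite multilin0 ?scaler0 //; apply/mapP; exists p => //.
    have /tnthP[i ->] : p \in in_tuple s by [].
    by apply/mapP; exists ((r^-1)%g i); rewrite ?mem_enum ?permKV.
  - by move=> p /mapP[a' _ ->]; apply: w_hom.
under eq_bigr => a _.
  rewrite symE !linear_sum.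
  under eq_bigr => r _.
    rewrite !linearZ /= (kmul_perm _ _ r) ?size_tuple // scalerA -signr_addb.
    rewrite addbb scale1r.
    have -> : [seq nth None a (r i) | i <- enum 'I_n] = G r a.
      by apply: eq_map => i; rewrite (tnth_nth None).
    over.
  over.
rewrite exchange_big /=.
under eq_bigr => r _ do
  rewrite (sum_tuple_perm r (fun b => kmul q b (unit_tens (g (map w b))))).
by rewrite sumr_const card_Sn scaler_nat.
Qed.
End Symmetrization.

(** * Compositions with coefficients in A *)

Section Composition.
Variables (k : fieldType) (W : dgSpace k).
Variable cmp : bool -> bool -> (seq W -> W) -> (seq W -> W) -> seq W -> W.

(* [cmp p q g h] stands for the pre-Lie product g o h of c(V) or a(V), for g of
   parity p and h of parity q, and [strX m] for the A-linear m o m. *)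
Record composition (strX : forall A : formal_cdga k, (seq W -> tens A W) ->
    forall i : fc_idx A, seq (bool * W) -> ubasis (A i) -> W) := Composition {
  cmp_sign : forall p q b c g h s, multilin g -> multilin h ->
    cmp p q ((-1) ^+ nat_of_bool b *: g) ((-1) ^+ nat_of_bool c *: h) s =
    (-1) ^+ (b (+) c) *: cmp p q g h s;
  cmp_grade : forall p q g h s, multilin g -> multilin h ->
    cmp p q g h s =
    \sum_(e : (size s).-tuple bool) cmp p q g h (unzip2 (grade e s));
  cmp_str : forall (A : formal_cdga k) (m : seq W -> tens A W) i s c,
    @homs k (dg_homData W) s -> (forall a, multilin (fun s => m s i a)) ->
    strX A m i s c = \sum_(a : ubasis (A i)) \sum_(b : ubasis (A i))
      (-1) ^+ (upar b (+) (upar a && upar b)) *: (umul a b c *: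
        cmp (~~ upar a) (~~ upar b) (m^~ i ^~ a) (m^~ i ^~ b) (unzip2 s)) }.
End Composition.

Section Compositions.
Variables (k : fieldType) (W : dgSpace k).

Lemma comp_shuffle0 (g h : seq W -> W) s : multilin g -> multilin h ->
  0 \in unzip2 s -> comp_shuffle g h s = 0.
Proof.
move=> gM hM s0; apply: big1 => -[e /= /eqP se] _.
have : 0 \in unzip2 (mask e s) \/ 0 \in unzip2 (mask (map negb e) s).
  elim: s e s0 se => [|[p x] s IHs] [|b e] //=.
  rewrite inE => /orP[/eqP<-|s0] [es].
    by case: b; [left | right]; rewrite inE eqxx.
  by case: (IHs e s0 es) => s0'; [left | right]; case: b; rewrite ?inE ?s0' ?orbT.
case=> h0; first by rewrite (multilin0 hM h0) (multilin_at0 gM [::]) scaler0.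
by rewrite (multilin0 gM) ?scaler0 // inE h0 orbT.
Qed.

Lemma comp_shuffleZ z1 z2 (g h : seq W -> W) s : multilin g ->
  comp_shuffle (z1 *: g) (z2 *: h) s = (z1 * z2) *: comp_shuffle g h s.
Proof.
move=> gM; rewrite /comp_shuffle scaler_sumr; apply: eq_bigr => e _.
rewrite [z1 *: g]scalrfctE [z2 *: h]scalrfctE.
by rewrite (multilinZ gM _ [::]) !scalerA mulrC.
Qed.

Lemma comp_insertZ q z1 z2 (g h : seq W -> W) s : multilin g ->
  comp_insert q (z1 *: g) (z2 *: h) s = (z1 * z2) *: comp_insert q g h s.
Proof.
move=> gM; rewrite /comp_insert scaler_sumr; apply: eq_bigr => i _.
rewrite scaler_sumr; apply: eq_bigr => l _.
rewrite [z1 *: g]scalrfctE [z2 *: h]scalrfctE.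
by rewrite (multilinZ gM) scalerA.
Qed.

(** Among the arguments only the inner value is expanded on the basis, giving e_b; the outer
    operation gives e_a. The sign is that of the odd operation and [s1] crossing e_b, then of
    reordering e_b e_a. *)
Lemma ext_compose (A : nilcdga k) (m : seq W -> ubasis A -> W)
    (s1 s2 s3 : seq (bool * W)) c :
  (forall a, multilin (m ^~ a)) ->
  @ext k A (dg_homData W) true (untagged m)
    ([seq (p.1, unit_tens p.2) | p <- s1] ++ (~~ par (unzip1 s2), m (unzip2 s2))
      :: [seq (p.1, unit_tens p.2) | p <- s3]) c =
  \sum_a \sum_b (-1) ^+ (~~ par (unzip1 s1) && upar b (+) (upar a && upar b)) *:
    (umul a b c *: m (unzip2 s1 ++ m (unzip2 s2) b :: unzip2 s3) a).
Proof.
move=> mM.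
have m0 s t p : untagged m (s ++ (p, 0) :: t) = 0.
  apply/funext => a; rewrite /untagged /unzip2 map_cat /=.
  exact: (multilin_at0 (mM a)).
rewrite ext_units //= exchange_big; apply: eq_bigr => b _ /=.
rewrite tens_scaleE -[[seq _ | _ <- s3]]cats0 ext_units => [|s p t].
  rewrite /= cats0 /smul scaler_sumr; apply: eq_bigr => a _.
  rewrite umulC -scalerA [LHS]scalerA -signr_addb [upar b && _]andbC.
  by rewrite /untagged /unzip2 map_cat.
by have := m0 (s1 ++ (~~ par (unzip1 s2) (+) upar b, m (unzip2 s2) b) :: s) t p;
  rewrite -catA.
Qed.

Lemma composition_c : @composition k W (fun p q g h => from_homs (comp_shuffle g h))
  (fun A => @str_shuffle k A W).
Proof.
split.
- move=> _ _ b c g h s gM hM; rewrite /from_homs scaler_sumr.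
  by apply: eq_bigr => e _; rewrite comp_shuffleZ // signr_addb.
- move=> _ _ g h s gM hM; apply: from_homs_grade => s'.
  exact: comp_shuffle0.
- move=> A m i s c hs mM.
  transitivity (\sum_(e : (size s).-tuple bool | true \in e)
      \sum_a \sum_b (-1) ^+ (upar b (+) (upar a && upar b)) *: (umul a b c *:
        ((-1) ^+ shuffle_sign e (unzip1 s) *:
          m (m (unzip2 (mask e s)) i b :: unzip2 (mask (map negb e) s)) i a))).
    apply: eq_bigr => e _.
    have -> := @ext_compose (A i) (m^~ i) [::] (mask e s) (mask (map negb e) s) c mM.
    rewrite scaler_sumr; apply: eq_bigr => a _; rewrite scaler_sumr.
    apply: eq_bigr => b _; rewrite scalerA mulrC -scalerA; congr (_ *: _).
    by rewrite scalerA mulrC -scalerA.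
  rewrite exchange_big; apply: eq_bigr => a _ /=.
  rewrite exchange_big; apply: eq_bigr => b _ /=.
  rewrite -!scaler_sumr from_homs_hom // => s'; exact: comp_shuffle0.
Qed.

Lemma tau_hom q b x : hom W b x -> tau q x = (-1) ^+ (q && b) *: x.
Proof.
rewrite /hom /tau => <-; rewrite !gpr_gpr.
by case: b; rewrite ?andbT ?andbF /= ?scaler0 ?addr0 ?add0r ?scale1r.
Qed.

Lemma multilin_signs (g : seq W -> W) q (s : seq (bool * W)) t :
  multilin g -> @homs k (dg_homData W) s ->
  g ([seq tau q p.2 | p <- s] ++ t) =
  (-1) ^+ (q && par (unzip1 s)) *: g (unzip2 s ++ t).
Proof.
move=> gM; rewrite -[LHS]/(g ([::] ++ _)) -[in RHS](cat0s (unzip2 s ++ t)).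
elim: s [::] => [|[b x] s IHs] s0 /=; first by rewrite andbF scale1r.
case/homs_cons=> /= hx hs; rewrite (tau_hom _ hx) (multilinZ gM) -cat_rcons IHs //.
rewrite scalerA -signr_addb cat_rcons; congr ((-1) ^+ (nat_of_bool _) *: _).
by rewrite -andb_addr.
Qed.

Lemma composition_a : @composition k W (fun _ q g h => comp_insert q g h)
  (fun A => @str_insert k A W).
Proof.
split.
- by move=> _ q b c g h s gM hM; rewrite comp_insertZ // signr_addb.
- by move=> _ q g h s gM hM; apply/additive_grade/comp_insert_additive.
- move=> A m i s c hs mM.
  transitivity (\sum_(r < size s) \sum_(l < size s - r) \sum_a \sum_b
      (-1) ^+ (upar b (+) (upar a && upar b)) *: (umul a b c *:
        m (map (tau (~~ upar b)) (take r (unzip2 s)) ++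
           m (take l.+1 (drop r (unzip2 s))) i b :: drop (r + l.+1) (unzip2 s)) i a)).
    apply: eq_bigr => r _; apply: eq_bigr => l _ /=.
    have -> := @ext_compose (A i) (m^~ i)
      [seq (p.1, tau true p.2) | p <- take r s] (take l.+1 (drop r s))
      (drop (r + l.+1) s) c mM.
    apply: eq_bigr => a _; apply: eq_bigr => b _.
    have homs_take : @homs k (dg_homData W) (take r s).
      by move=> p /mem_take /hs.
    have -> : unzip1 [seq (p.1, tau true p.2) | p <- take r s] = unzip1 (take r s).
      by rewrite /unzip1 -map_comp.
    have -> : unzip2 [seq (p.1, tau true p.2) | p <- take r s] =
      [seq tau true p.2 | p <- take r s] by rewrite /unzip2 -map_comp.
    have -> : map (tau (~~ upar b)) (take r (unzip2 s)) =
      [seq tau (~~ upar b) p.2 | p <- take r s] by rewrite -map_take -map_comp.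
    (* [str_insert] twists by the odd parity and [comp_insert] by |b| + 1; the difference is the
       sign of e_b crossing the arguments before the block. *)
    rewrite (multilin_signs _ _ (mM a)) // (multilin_signs _ _ (mM a)) //.
    rewrite /unzip2 -map_drop -map_take -map_drop.
    move: (m _ i a) (par _) => w p.
    rewrite !scalerA ![_ * umul a b c]mulrC -!mulrA -!signr_addb.
    congr (_ * (-1) ^+ (nat_of_bool _) *: _).
    by case: p (upar a) (upar b) => [] [] [].
  have compE a b : comp_insert (~~ upar b) (m ^~ i ^~ a) (m ^~ i ^~ b) (unzip2 s) =
      \sum_(r < size s) \sum_(l < size s - r)
        m (map (tau (~~ upar b)) (take r (unzip2 s)) ++
          m (take l.+1 (drop r (unzip2 s))) i b :: drop (r + l.+1) (unzip2 s)) i a.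
    by rewrite /comp_insert size_map.
  under [RHS]eq_bigr => a _.
    under eq_bigr => b _ do rewrite compE !scaler_sumr.
    rewrite exchange_big /=; over.
  rewrite [RHS]exchange_big; apply: eq_bigr => r _ /=.
  under [RHS]eq_bigr => a _.
    under eq_bigr => b _ do rewrite !scaler_sumr.
    rewrite exchange_big /=; over.
  by rewrite [RHS]exchange_big.
Qed.
End Compositions.

(** * The Maurer-Cartan equation of the extended algebra *)

(** [kmul] acts on coordinates through scalars of the field, so the two components of a pair can be
    evaluated separately. *)
Lemma kmul_map (k : fieldType) (A : nilcdga k) (X Y : lmodType k)
  (phi : {linear X -> Y}) q s (v : ubasis A -> X) c :
  phi (kmul q s v c) = kmul q s (phi \o v) c.
Proof.
elim: s q c => //= a s IHs q c.
rewrite ![(_ *: smul _ _) _]/(_ *: smul _ _ _) linearZ linear_sum /=.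
by congr (_ *: _); apply: eq_bigr => b _; rewrite linearZ /= IHs.
Qed.

Lemma kmul_unit_map (k : fieldType) (A : nilcdga k) (X Y : lmodType k)
  (phi : {linear X -> Y}) q (s : seq (ubasis A)) (u : X) c :
  phi (kmul q s (unit_tens u) c) = kmul q s (unit_tens (phi u)) c.
Proof.
rewrite kmul_map; congr (kmul q s _ c).
by apply/funext => -[b|] //=; rewrite linear0.
Qed.

Lemma kmul_pair (k : fieldType) (A : nilcdga k) (X : lmodType k) q
  (a b c : ubasis A) (u : X) : kmul q [:: a; b] (unit_tens u) c =
  (-1) ^+ (q && upar a (+) (q (+) upar a) && upar b) *: (umul a b c *: u).
Proof.
rewrite !kmul_cons /= linearZ /= scalerA -signr_addb smul_unit.
congr (_ *: _); rewrite /smul (bigD1 b) //= eqxx scale1r big1 ?addr0 // => d.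
by rewrite eq_sym => /negPf ->; rewrite scale0r scaler0.
Qed.

Section TildeEval.
Variables (k : fieldType) (W : dgSpace k).

Definition tilde_map (s : seq W) (x : tilde_sort W) : W := x.1 s.
Arguments tilde_map : simpl never.

Definition tilde_vec (x : tilde_sort W) : W := x.2.
Arguments tilde_vec : simpl never.

Lemma tilde_map_linear s : linear (tilde_map s). Proof. by []. Qed.
HB.instance Definition _ s :=
  GRing.isLinear.Build k (tilde_sort W) W _ (tilde_map s) (tilde_map_linear s).

Lemma tilde_vec_linear : linear tilde_vec. Proof. by []. Qed.
HB.instance Definition _ :=
  GRing.isLinear.Build k (tilde_sort W) W _ tilde_vec tilde_vec_linear.

Lemma tilde_mapD s x y : tilde_map s (x + y) = tilde_map s x + tilde_map s y.
Proof. by []. Qed.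

Lemma tilde_mapZ s a x : tilde_map s (a *: x) = a *: tilde_map s x.
Proof. by []. Qed.

Lemma tilde_map_sum s I (l : seq I) P (F : I -> tilde_sort W) :
  tilde_map s (\sum_(j <- l | P j) F j) = \sum_(j <- l | P j) tilde_map s (F j).
Proof. exact: linear_sum. Qed.

Lemma tilde_vec_sum I (l : seq I) P (F : I -> tilde_sort W) :
  tilde_vec (\sum_(j <- l | P j) F j) = \sum_(j <- l | P j) tilde_vec (F j).
Proof. exact: linear_sum. Qed.

Lemma tilde_vecD x y : tilde_vec (x + y) = tilde_vec x + tilde_vec y.
Proof. by []. Qed.

Lemma tilde_vecZ a x : tilde_vec (a *: x) = a *: tilde_vec x.
Proof. by []. Qed.

Lemma tilde_eq0 (x : tilde_sort W) :
  x = 0 <-> (forall s, tilde_map s x = 0) /\ tilde_vec x = 0.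
Proof.
split=> [->|[x1 x2]]; first by rewrite linear0; split=> // s; rewrite linear0.
by case: x x1 x2 => f w /= x1 x2; congr (_, _) => //; apply/funext.
Qed.
End TildeEval.

(** * The two components of the Maurer-Cartan equation *)

Section TildeMC.
Variables (k : fieldType) (A : formal_cdga k) (W : dgSpace k).
Variable mem : bool -> (seq W -> W) -> Prop.
Variable br : bool -> bool -> (seq W -> W) -> (seq W -> W) -> seq W -> W.
Variable act : (seq W -> W) -> seq W -> W.
Variable cmp : bool -> bool -> (seq W -> W) -> (seq W -> W) -> seq W -> W.
Variable strX : forall A : formal_cdga k, (seq W -> tens A W) ->
  forall i : fc_idx A, seq (bool * W) -> ubasis (A i) -> W.
(* [act g] consists of [r n] terms that agree with g on xi^n: r n = 1 for c(V),
   and r n = n! for the symmetrization. *)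
Variable r : nat -> k.
Hypothesis char0 : [pchar k] =i pred0.
Hypothesis mem_in_a : forall b g, mem b g -> in_a b g.
Hypothesis mem_sign : forall b e g, mem b g -> mem b ((-1) ^+ nat_of_bool e *: g).
Hypothesis brE : forall p q g h s, br p q g h s =
  cmp p q g h s - (-1) ^+ (p && q) *: cmp q p h g s.
Hypothesis cmpP : composition cmp strX.
Hypothesis actE : forall (B : nilcdga k) g (w : ubasis B -> W) q n,
  multilin g -> (forall a, hom W (upar a) (w a)) ->
  \sum_(a : n.-tuple (ubasis B)) kmul q a (unit_tens (act g (map w a))) =
  r n *: \sum_(a : n.-tuple (ubasis B)) kmul q a (unit_tens (g (map w a))).

Local Notation U := (tilde mem).
Local Notation op s i := (@const_op k A U (@tilde_op k W mem br act) s i).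
Implicit Types (x : tens A U) (i : fc_idx A).

(** The sign -1 is that of the differential of Pi g; (-1)^|c| comes from passing between g_c and
    m_c. *)
Lemma tens_dif_map x i (c : ubasis (A i)) s :
  let m := (tilde_split x).1 in
  tilde_map s (tens_dif false (x i) c) =
  - (-1) ^+ upar c *: (\sum_b udif b c *: m s i b
    + (-1) ^+ upar c *: dif W (m s i c) + insert_dif (fun s => m s i c) s).
Proof.
have -> : tens_dif false (x i) c = \sum_b udif b c *: x i b + (-1) ^+ upar c *:
    (- (der_dif (~~ upar c) (x i c).1 : seq W -> W), dif W (x i c).2) by [].
rewrite linearD linear_sum linearZ /= -addrA scalerDr; congr (_ + _).
  rewrite scaler_sumr; apply: eq_bigr => b _; rewrite linearZ /= !scalerA.
  (* d_A is odd, so only the indices with |c| = |b| + 1 contribute, and there the overall sign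
     undoes the one in m_b. *)
  have [cb|ncb] := eqVneq (upar c) (~~ upar b); last first.
    by rewrite udif_parity // !(mulr0, mul0r) !scale0r.
  rewrite cb -mulrA (_ : - _ * _ = 1) ?mulr1 //.
  by case: (upar b); rewrite /= ?expr0 ?expr1 ?mulr1 ?opprK ?mulN1r ?opprK.
rewrite /tilde_map /= /der_dif.
have -> : insert_dif (fun s => (-1) ^+ upar c *: (x i c).1 s) s =
    (-1) ^+ upar c *: insert_dif (x i c).1 s.
  by rewrite /insert_dif scaler_sumr.
transitivity ((-1) ^+ upar c *:
    - (dif W ((x i c).1 s) - (-1) ^+ (~~ upar c) *: insert_dif (x i c).1 s)) => //.
rewrite [dif W (_ *: _)]linearZ /=.
move: (dif W _) (insert_dif _ _) => D I.
by rewrite signrN !scaleNr opprK scalerN !scalerDr !scalerA -signr_addb addbb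
  expr0 mul1r.
Qed.

(** The bracket of the components at a and b contributes m_a o m_b and m_b o m_a; exchanging the
    indices turns the second sum into the first, whence the factor 2. *)
Lemma tilde_quadratic x i (c : ubasis (A i)) s :
  (forall a, multilin (x i a).1) ->
  let m := (tilde_split x).1 in
  tilde_map s (ext true (fun s => op s i) (nseq 2 (false, x i)) c) =
  2%:R *: (- (-1) ^+ upar c *: \sum_a \sum_b
      (-1) ^+ (upar b (+) (upar a && upar b)) *: (umul a b c *:
        cmp (~~ upar a) (~~ upar b) (m^~ i ^~ a) (m^~ i ^~ b) s)).
Proof.
move=> xM m; rewrite ext_nseq fct_sumE linear_sum.
rewrite (sum_tupleS 1 (fun t => tilde_map s
  (kmul true t (op [seq (upar a, x i a) | a <- t] i) c))).
pose T a b := - (-1) ^+ upar c *: ((-1) ^+ (upar b (+) (upar a && upar b)) *: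
  (umul a b c *: cmp (~~ upar a) (~~ upar b) (m^~ i ^~ a) (m^~ i ^~ b) s)).
transitivity (\sum_a \sum_b (T a b + T b a)); last first.
  under eq_bigr do rewrite big_split /=.
  rewrite big_split /= [X in _ + X]exchange_big /= scaler_nat mulr2n.
  by rewrite scaler_sumr; congr (_ + _); apply: eq_bigr => a _; rewrite scaler_sumr.
apply: eq_bigr => a _; rewrite (sum_tupleS 0 (fun t => tilde_map s
  (kmul true (a :: t) (op ((upar a, x i a) :: [seq (upar b, x i b) | b <- t]) i) c))).
apply: eq_bigr => b _; rewrite (sum_tuple0 (fun t => tilde_map s
  (kmul true [:: a, b & t] (op [:: (upar a, x i a), (upar b, x i b) &
     [seq (upar b, x i b) | b <- t]] i) c))).
rewrite kmul_unit_map kmul_pair.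
transitivity ((-1) ^+ (upar a (+) (~~ upar a && upar b)) *: (umul a b c *:
  ((-1) ^+ (~~ upar a) *: br (~~ upar a) (~~ upar b) (x i a).1 (x i b).1 s))) => //.
rewrite brE /T ![cmp _ _ (m ^~ i ^~ _) _ _](cmp_sign cmpP) //.
rewrite [umul b a c]umulC.
(* The coefficient vanishes unless |c| = |a| + |b|, after which the signs agree for each choice of
   parities. *)
have [cE|cN] := eqVneq (upar c) (upar a (+) upar b); last first.
  by rewrite umul_parity // ?mulr0 !scale0r !scaler0 addr0.
move: (cmp _ _ _ _ s) (cmp _ _ _ _ s) (umul a b c) => C1 C2 u.
rewrite cE !scalerBr !scalerA -scaleNr; congr (_ *: _ + _ *: _).
  by case: (upar a); case: (upar b); rewrite /= ?expr0 ?expr1; ring.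
by case: (upar a); case: (upar b); rewrite /= ?expr0 ?expr1; ring.
Qed.

Lemma tilde_bracket_size x i n (c : ubasis (A i)) s : n != 2 ->
  tilde_map s (ext true (fun s => op s i) (nseq n (false, x i)) c) = 0.
Proof.
move=> n2; rewrite ext_nseq fct_sumE linear_sum big1 // => t _ /=.
rewrite kmul_unit_map.
transitivity (kmul true t (@unit_tens k (A i) W
  (tilde_bracket (mem := mem) br [seq (upar a, x i a) | a <- t] s)) c) => //.
rewrite (_ : tilde_bracket _ _ _ = 0) ?linear0 //.
by case: t => -[|a [|b [|e t]]] //= /eqP E; rewrite -E in n2.
Qed.

Lemma tilde_actE d (s : seq (bool * U)) n : size s = n.+2 ->
  tilde_act (mem := mem) act s = \sum_(j < n.+2)
    (-1) ^+ ((nth d s j).1 && par (unzip1 (take j s))) *: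
      act (nth d s j).2.1 [seq p.2.2 | p <- take j s ++ drop j.+1 s].
Proof.
move=> ss; rewrite /tilde_act leqNgt [in (_ < size s)%N]ss /=; case: (n.+2) / ss.
by apply: eq_bigr => j _; rewrite (tnth_nth d).
Qed.

(** Bringing Pi g to the front from a given slot costs the same sign as bringing its coefficient e_a
    there, so all n + 1 slots contribute equally. *)
Lemma tilde_action x i n (c : ubasis (A i)) :
  (forall a, multilin (x i a).1) ->
  (forall a, hom W (upar a) (x i a).2) -> (0 < n)%N ->
  let m := (tilde_split x).1 in
  let xi := (tilde_split x).2 in
  tilde_vec (ext true (fun s => op s i) (nseq n.+1 (false, x i)) c) =
  n.+1%:R *: (r n *:
    @ext k (A i) (dg_homData W) true (fun s => untagged m s i)
      (nseq n (false, xi i)) c).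
Proof.
case: n => // n xM xh _ m xi; rewrite !ext_nseq fct_sumE linear_sum.
pose w a := (x i a).2.
pose F (j : nat) (t : seq (ubasis (A i))) :=
  (-1) ^+ (upar (nth None t j) && upars (take j t)) *:
    act (x i (nth None t j)).1 (map w (take j t ++ drop j.+1 t)).
transitivity (\sum_(t : n.+2.-tuple (ubasis (A i))) \sum_(j < n.+2)
    kmul true t (unit_tens (F j t)) c).
  apply: eq_bigr => t _; rewrite kmul_unit_map.
  transitivity (kmul true t (@unit_tens k (A i) W
    (tilde_act (mem := mem) act [seq (upar a, x i a) | a <- t])) c) => //.
  rewrite (@tilde_actE (upar (None : ubasis (A i)), x i None) _ n); last first.
    by rewrite size_map size_tuple.
  rewrite !linear_sum fct_sumE; apply: eq_bigr => j _.
  congr (kmul _ _ (unit_tens _) c).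
  rewrite /F (nth_map None) ?size_tuple // -!map_take -map_drop -map_cat.
  by rewrite /upars /unzip1 -!map_comp.
rewrite exchange_big /=.
transitivity (\sum_(j < n.+2) (r n.+1 *: \sum_(t : n.+1.-tuple (ubasis (A i)))
    kmul true t (m (map w t) i)) c); last first.
  rewrite sumr_const card_ord scaler_nat; congr (_ *+ _).
  transitivity (r n.+1 *: (\sum_(t : n.+1.-tuple (ubasis (A i)))
    kmul true t (m (map w t) i)) c) => //.
  congr (_ *: _); rewrite !fct_sumE; apply: eq_bigr => t _.
  by rewrite /untagged /unzip2 -map_comp.
apply: eq_bigr => j _.
rewrite (@sum_tuple_insert _ _ j n.+1 (fun t => kmul true t (unit_tens (F j t)) c))
  ?leq_ord //.
have insertE a (t : n.+1.-tuple (ubasis (A i))) :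
    kmul true (take j t ++ a :: drop j t)
      (unit_tens (F j (take j t ++ a :: drop j t))) =
    kmul true (a :: t) (unit_tens (act (x i a).1 (map w t))).
  have sj : size (take j t) = j by rewrite size_takel // size_tuple leq_ord.
  rewrite /F nth_cat sj ltnn subnn /= take_size_cat // drop_cat sj ltnNge leqnSn /=.
  rewrite subSnn /= drop0 cat_take_drop !linearZ /= -kmul_move.
  by rewrite cat_take_drop.
under eq_bigr do under eq_bigr do rewrite insertE.
(* The odd operation crossing e_a gives (-1)^|a|, exactly the sign relating g_a to m_a; [kmul_smul]
   then carries e_a onto the value of m_a. *)
have Ea a : \sum_(t : n.+1.-tuple (ubasis (A i)))
    kmul true (a :: t) (unit_tens (act (x i a).1 (map w t))) =
    r n.+1 *: \sum_(t : n.+1.-tuple (ubasis (A i)))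
      kmul true t (smul a (unit_tens (m (map w t) i a))).
  under eq_bigr do rewrite kmul_cons.
  rewrite -scaler_sumr -linear_sum actE // linearZ /= scalerA mulrC -scalerA.
  congr (_ *: _); rewrite linear_sum scaler_sumr; apply: eq_bigr => t _.
  rewrite kmul_smul.
  have -> : m (map w t) i a = (-1) ^+ upar a *: (x i a).1 (map w t) by [].
  by rewrite !linearZ.
transitivity ((\sum_a \sum_(t : n.+1.-tuple (ubasis (A i)))
    kmul true (a :: t) (unit_tens (act (x i a).1 (map w t)))) c).
  by rewrite fct_sumE; apply: eq_bigr => a _; rewrite fct_sumE.
under eq_bigr do rewrite Ea.
rewrite -scaler_sumr exchange_big; congr ((_ *: _) c); apply: eq_bigr => t _.
by rewrite -linear_sum -unit_decomp.
Qed.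

Lemma natr_neq0 n : n.+1%:R != 0 :> k.
Proof. by have /pcharf0P -> := char0. Qed.

Definition tilde_lhs x i N (c : ubasis (A i)) : U :=
  tens_dif false (x i) c + \sum_(1 <= n < N.+1)
    (n`!%:R)^-1 *: ext true (fun s => op s i) (nseq n (false, x i)) c.

(** The first component sees only the differential and the binary product, so any partial sum
    reaching the latter gives the same value; 1/2! cancels the 2 of [tilde_quadratic]. *)
Lemma tilde_lhs_map x i N (c : ubasis (A i)) s :
  (forall a, multilin (x i a).1) -> (1 < N)%N ->
  let m := (tilde_split x).1 in
  tilde_map s (tilde_lhs x N c) = - (-1) ^+ upar c *:
    ((\sum_b udif b c *: m s i b + (-1) ^+ upar c *: dif W (m s i c)
      + insert_dif (fun s => m s i c) s) +
     \sum_a \sum_b (-1) ^+ (upar b (+) (upar a && upar b)) *: (umul a b c *: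
        cmp (~~ upar a) (~~ upar b) (m^~ i ^~ a) (m^~ i ^~ b) s)).
Proof.
case: N => [|[|N]] // xM _ m; rewrite /tilde_lhs tilde_mapD tens_dif_map [RHS]scalerDr.
congr (_ + _); rewrite tilde_map_sum big_ltn // big_ltn // big_nat_cond big1.
  rewrite addr0 !tilde_mapZ (tilde_bracket_size _ _ (n := 1)) // scaler0 add0r.
  rewrite tilde_quadratic // (_ : 2`! = 2%N) // [LHS]scalerA mulVf ?scale1r //.
  exact: (natr_neq0 1).
move=> n; rewrite andbT => /andP[n3 _].
rewrite tilde_mapZ tilde_bracket_size ?scaler0 //.
by apply: contraTneq n3 => ->.
Qed.

(** The unary action term vanishes, so the sum on the left effectively starts at two and shifts onto
    the one on the right. *)
Lemma tilde_lhs_vec x i N (c : ubasis (A i)) :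
  (forall a, multilin (x i a).1) -> (forall a, hom W (upar a) (x i a).2) ->
  let m := (tilde_split x).1 in
  let xi := (tilde_split x).2 in
  tilde_vec (tilde_lhs x N.+1 c) =
  @tens_dif k (A i) (dg_homData W) false (xi i) c + \sum_(1 <= n < N.+1)
    ((n`!%:R)^-1 * r n) *: @ext k (A i) (dg_homData W) true
      (fun s => untagged m s i) (nseq n (false, xi i)) c.
Proof.
move=> xM xh m xi; rewrite /tilde_lhs tilde_vecD; congr (_ + _).
  have -> : tens_dif false (x i) c = \sum_b udif b c *: x i b + (-1) ^+ upar c *:
    (- (der_dif (~~ upar c) (x i c).1 : seq W -> W), dif W (x i c).2) by [].
  by rewrite tilde_vecD tilde_vec_sum.
rewrite tilde_vec_sum big_ltn // tilde_vecZ ext_nseq fct_sumE tilde_vec_sum.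
rewrite big1 ?scaler0 ?add0r => [|t _]; last first.
  rewrite kmul_unit_map; transitivity (kmul true t (@unit_tens k (A i) W
    (tilde_act (mem := mem) act [seq (upar a, x i a) | a <- t])) c) => //.
  by rewrite /tilde_act ifT ?linear0 // size_map size_tuple.
rewrite big_add1; apply: eq_big_nat => n /andP[n0 _].
rewrite tilde_vecZ tilde_action // !scalerA factS natrM invfM.
by rewrite mulrACA mulVf ?natr_neq0 // mul1r.
Qed.
(** The equation of an infinity-structure is imposed on homogeneous lists, whereas the first
    component is a map on all lists; additivity in each argument bridges the two. *)
Lemma tilde_lhs_map_eq0 x i N (c : ubasis (A i)) :
  (forall a, multilin (x i a).1) -> (1 < N)%N ->
  let m := (tilde_split x).1 in
  (forall s, tilde_map s (tilde_lhs x N c) = 0) <->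
  forall s, @homs k (dg_homData W) s -> str_dif m s c + @strX A m i s c = 0.
Proof.
move=> xM N1 m.
have mM a : multilin (m ^~ i ^~ a) by apply: (multilin_scale _ (xM a)).
pose D s := \sum_b udif b c *: m s i b + (-1) ^+ upar c *: dif W (m s i c)
      + insert_dif (fun s => m s i c) s.
pose Q s := \sum_a \sum_b (-1) ^+ (upar b (+) (upar a && upar b)) *:
  (umul a b c *:
    cmp (~~ upar a) (~~ upar b) (m^~ i ^~ a) (m^~ i ^~ b) s).
have lhsE s : tilde_map s (tilde_lhs x N c) = - (-1) ^+ upar c *: (D s + Q s).
  exact: tilde_lhs_map.
have DQ s : @homs k (dg_homData W) s ->
    str_dif m s c + strX m s c = D (unzip2 s) + Q (unzip2 s).
  by move=> hs; rewrite (cmp_str cmpP).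
have D_grade s : D s = \sum_(e : (size s).-tuple bool) D (unzip2 (grade e s)).
  apply: additive_grade => s1 s2 y z; rewrite /D.
  under eq_bigr do rewrite (multilinD (mM _)) scalerDr.
  rewrite big_split /= (multilinD (mM _)) linearD scalerDr.
  rewrite !(insert_difE _ (mM c)) comp_insert_additive //; last exact: multilin_dif.
  by rewrite [RHS]addrACA; congr (_ + _); rewrite [RHS]addrACA.
have Q_grade s : Q s = \sum_(e : (size s).-tuple bool) Q (unzip2 (grade e s)).
  rewrite exchange_big; apply: eq_bigr => a _ /=.
  rewrite exchange_big; apply: eq_bigr => b _ /=.
  by rewrite -!scaler_sumr (cmp_grade cmpP).
split=> [lhs0 s hs | str0 s].
  have /eqP := lhs0 (unzip2 s); rewrite lhsE DQ // scaler_eq0 oppr_eq0.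
  by rewrite signr_eq0 => /eqP.
rewrite lhsE D_grade Q_grade -big_split big1 ?scaler0 // => e _ /=.
by rewrite -DQ ?str0 //; apply: homs_grade.
Qed.

(** The transition maps preserve parity, so the signs (-1)^|a| of [tilde_split] commute with
    them. *)
Lemma tilde_in_Aplus x : in_Aplus x <->
  (forall s, in_Aplus ((tilde_split x).1 s)) /\ in_Aplus (tilde_split x).2.
Proof.
have utr_sign i j b c (v : W) : fc_le i j ->
    utr (fc_tr (f := A) i j) b c *: ((-1) ^+ upar b *: v) =
    (-1) ^+ upar c *: (utr (fc_tr (f := A) i j) b c *: v).
  move=> le_ij; have [->|ne] := eqVneq (upar c) (upar b).
    by rewrite !scalerA mulrC.
  by rewrite utr_parity ?scale0r ?scaler0 // => p y; apply: fc_tr_gpr.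
split=> [[xC x0] | [m_in [xiC xi0]]].
  split=> [s|]; split=> [i j le_ij c|i]; rewrite /= ?x0 ?scaler0 //.
  - under eq_bigr do rewrite utr_sign //.
    rewrite -scaler_sumr; congr (_ *: _).
    have /(congr1 (tilde_map s)) := xC i j le_ij c.
    by rewrite tilde_map_sum.
  - have /(congr1 (@tilde_vec k W)) := xC i j le_ij c.
    by rewrite tilde_vec_sum.
split=> [i j le_ij c | i].
  apply/eqP; rewrite -subr_eq0; apply/eqP/tilde_eq0; split=> [s|].
    rewrite tilde_mapD -scaleN1r tilde_mapZ scaleN1r tilde_map_sum; apply/eqP.
    rewrite subr_eq0; apply/eqP; apply: (scalerI (a := (-1) ^+ upar c)).
      by rewrite signr_eq0.
    have /= -> := (m_in s).1 i j le_ij c.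
    by rewrite scaler_sumr; apply: eq_bigr => b _; rewrite utr_sign.
  rewrite tilde_vecD -scaleN1r tilde_vecZ scaleN1r tilde_vec_sum; apply/eqP.
  by rewrite subr_eq0; apply/eqP; apply: xiC.
apply/tilde_eq0; split=> [s|]; last exact: xi0.
by have /= := (m_in s).2 i; rewrite expr0 scale1r.
Qed.

Lemma tilde_MC_set x :
  MC_Linfty (@const_op k A U (@tilde_op k W mem br act)) x <->
  let m := (tilde_split x).1 in
  [/\ forall s, in_Aplus (m s),
      forall i (a : ubasis (A i)), mem (~~ upar a) (fun s => m s i a),
      forall s, @homs k (dg_homData W) s -> forall i c,
        str_dif m s c + @strX A m i s c = 0 &
      @MC_set k A (dg_homData W) (fun n => (n`!%:R)^-1 * r n) (untagged m)
        (tilde_split x).2].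
Proof.
have signK (f : seq W -> W) b :
    (-1) ^+ nat_of_bool b *: ((-1) ^+ nat_of_bool b *: f) = f.
  by rewrite scalerA -signr_addb addbb scale1r.
split=> [[/tilde_in_Aplus[mA xiA] xh xE] m | [mA mh mE [xiA xih xiE]]].
  have xM i a : multilin (x i a).1 by have [/mem_in_a[]] := xh i a.
  have xw i a : hom W (upar a) (x i a).2 by have [] := xh i a.
  split=> //.
  - by move=> i a; apply: (mem_sign _ (xh i a).1).
  (* The bound 2 makes the partial sum contain the binary product. *)
  - move=> s hs i c; have [N0 xE0] := xE i.
    apply: ((tilde_lhs_map_eq0 c (xM i) (leq_maxr N0 2)).1 _ s hs) => s'.
    by have /tilde_eq0[] := xE0 _ (leq_maxl N0 2) c.
  - split=> // i; have [N0 xE0] := xE i; exists N0 => N le_N c.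
    have /tilde_eq0[_] := xE0 _ (leqW le_N) c.
    by rewrite -[tens_dif _ _ _ + _]/(tilde_lhs x N.+1 c) tilde_lhs_vec.
have xh i (a : ubasis (A i)) : mem (~~ upar a) (x i a).1.
  by rewrite -[(x i a).1](signK _ (upar a)); apply: mem_sign; apply: mh.
have xM i a : multilin (x i a).1 by have /mem_in_a[] := xh i a.
split; [exact/tilde_in_Aplus | by move=> i a; split; [apply: xh | apply: xih] |].
(* One step for the index shift, and one more to ensure that the binary product is included. *)
move=> i; have [N0 xiE0] := xiE i; exists N0.+2 => -[//|[//|N]] le_N c.
rewrite -[tens_dif _ _ _ + _]/(tilde_lhs x N.+2 c); apply/tilde_eq0; split.
  by apply/tilde_lhs_map_eq0 => // s hs; apply: mE.
by rewrite tilde_lhs_vec; [exact: (xiE0 N.+1 (ltnW le_N) c) | | apply: xih].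
Qed.

(** The splitting only inserts signs, so the same signs invert it. *)
Lemma tilde_split_bij : bijective (@tilde_split k W mem A).
Proof.
exists (fun (p : (seq W -> tens A W) * tens A W) i a =>
  (((fun s => (-1) ^+ upar a *: p.1 s i a), p.2 i a) : U)).
  move=> x; apply: functional_extensionality_dep => i; apply/funext => a.
  rewrite /=; case: (x i a) => f w; congr (_, _) => /=; apply/funext => s.
  by rewrite scalerA -signr_addb addbb scale1r.
case=> m xi; congr (_, _); apply/funext => s.
apply: functional_extensionality_dep => i; apply/funext => a /=.
by rewrite scalerA -signr_addb addbb scale1r.
Qed.
End TildeMC.

(** * Stability of the four membership conditions under scalars *)

Section ScaledMaps.
Variables (k : fieldType) (W : dgSpace k).

Lemma in_a_scale z b (g : seq W -> W) : in_a b g -> in_a b (z *: g).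
Proof.
case=> gM gh; split=> [|s hs]; first exact: multilin_scale.
by rewrite scalrfctE /hom linearZ /= gh.
Qed.

Lemma symmetric_map_scale (X : lmodType k) z (f : seq W -> X) :
  symmetric_map f -> symmetric_map (z *: f).
Proof.
move=> fS s hs r; rewrite scalrfctE (fS s hs r).
by rewrite !scalerA mulrC.
Qed.

Lemma cyclic_map_scale (X : lmodType k) z (f : seq W -> X) :
  cyclic_map f -> cyclic_map (z *: f).
Proof.
move=> fC s p hs; rewrite scalrfctE (fC s p hs).
by rewrite !scalerA mulrC.
Qed.

Lemma in_c_scale z b (g : seq W -> W) : in_c b g -> in_c b (z *: g).
Proof. by case=> /(in_a_scale z) ? /(symmetric_map_scale z). Qed.

Variable om : W -> W -> k.
Hypothesis omZ : forall z x y, om (z *: x) y = z * om x y.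

Lemma form_of_scale z (g : seq W -> W) : form_of om (z *: g) = z *: form_of om g.
Proof.
by apply/funext => -[|x s]; rewrite !scalrfctE /= ?scaler0 // omZ.
Qed.

Lemma in_as_scale z b (g : seq W -> W) : in_as om b g -> in_as om b (z *: g).
Proof.
by case=> /(in_a_scale z) ? /(cyclic_map_scale z); rewrite -form_of_scale.
Qed.

Lemma in_cs_scale z b (g : seq W -> W) : in_cs om b g -> in_cs om b (z *: g).
Proof.
by case=> /(in_c_scale z) ? /(symmetric_map_scale z); rewrite -form_of_scale.
Qed.
End ScaledMaps.

Lemma omegaZ (k : fieldType) (V : dgSpace k) (B : scalarProduct V) z (x y : Pi V) :
  omega B (z *: x) y = z * omega B x y.
Proof.
have BZ (u : V) : B (z *: u) y = z * B u y.
  (* Linearity at zero vectors shows that the form vanishes when its left argument is 0. *)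
  have := sp_linl B 1 0 0 y; rewrite scaler0 addr0 mul1r.
  move=> /(canLR (addrK _)); rewrite subrr => B0.
  by have := sp_linl B z u 0 y; rewrite addr0 -B0 addr0.
by rewrite /omega -BZ /tau !linearZ /= scalerDr !scalerA mulrC.
Qed.

Lemma set_bij_of_bij (T U : Type) (D : set T) (E : set U) (f : T -> U) :
  bijective f -> (forall x, D x <-> E (f x)) -> set_bij D E f.
Proof.
case=> g fK gK DE; split=> [x /DE //|x y _ _ /(can_inj fK) //|y Ey].
by exists (g y); rewrite ?gK //; apply/DE; rewrite gK.
Qed.

(** * The four cases *)

Local Open Scope classical_set_scope.

Theorem theorem3p10 (k : fieldType) (char0 : [pchar k] =i pred0)
  (A : formal_cdga k) (V : dgSpace k) :
  [/\ set_bij (@MC_tilde_c k A V)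
        [set p : (seq (Pi V) -> tens A (Pi V)) * tens A (Pi V)
           | Linfty p.1 /\ MC_L p.1 p.2]
        (@tilde_split k (Pi V) (@in_c k (Pi V)) A),
      forall B : scalarProduct V,
      set_bij (@MC_tilde_cs k A V B)
        [set p : (seq (Pi V) -> tens A (Pi V)) * tens A (Pi V)
           | cyclic_Linfty (omega B) p.1 /\ MC_L p.1 p.2]
        (@tilde_split k (Pi V) (in_cs (omega B)) A),
      set_bij (@MC_tilde_a k A V)
        [set p : (seq (Pi V) -> tens A (Pi V)) * tens A (Pi V)
           | Ainfty p.1 /\ MC_A p.1 p.2]
        (@tilde_split k (Pi V) (@in_a k (Pi V)) A) &
      forall B : scalarProduct V,
      set_bij (@MC_tilde_as k A V B)
        [set p : (seq (Pi V) -> tens A (Pi V)) * tens A (Pi V)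
           | cyclic_Ainfty (omega B) p.1 /\ MC_A p.1 p.2]
        (@tilde_split k (Pi V) (in_as (omega B)) A)].
Proof.
(* [tilde_MC_set] produces the weights r_n / n!: those of an L-infinity structure for r_n = 1, and
   of an A-infinity structure for r_n = n!. *)
have coefL : (fun n => (n`!%:R)^-1 * 1) = (fun n => (n`!%:R)^-1) :> (nat -> k).
  by apply/funext => n; rewrite mulr1.
have coefA : (fun n => (n`!%:R)^-1 * n`!%:R) = (fun=> 1) :> (nat -> k).
  apply/funext => n; rewrite mulVf //.
  by have := fact_gt0 n; case: (n`!) => // j _; apply: natr_neq0.
have idE (B : nilcdga k) (g : seq (Pi V) -> Pi V) (w : ubasis B -> Pi V) q n :
    multilin g -> (forall a, hom (Pi V) (upar a) (w a)) ->
  \sum_(a : n.-tuple (ubasis B)) kmul q a (unit_tens (id g (map w a))) =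
  1 *: \sum_(a : n.-tuple (ubasis B)) kmul q a (unit_tens (g (map w a))).
  by rewrite scale1r.
have symE := fun B g w q n => @sum_symmetrize k B (Pi V) g w q n.
have MCc mem mem_a mem_sign := @tilde_MC_set k A (Pi V) mem (@bracket_c k (Pi V))
  id _ _ (fun=> 1) char0 mem_a mem_sign (fun _ _ _ _ _ => erefl)
  (composition_c (Pi V)) idE.
have MCa mem mem_a mem_sign := @tilde_MC_set k A (Pi V) mem (@bracket_a k (Pi V))
  (@symmetrize k (Pi V)) _ _ (fun n => n`!%:R) char0 mem_a mem_sign
  (fun _ _ _ _ _ => erefl) (composition_a (Pi V)) symE.
rewrite coefL in MCc; rewrite coefA in MCa.
split=> [|B||B]; apply: set_bij_of_bij (@tilde_split_bij _ _ _ _) _ => x.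
- have mem_a b g : @in_c k (Pi V) b g -> in_a b g by case.
  apply: (iff_trans (MCc _ mem_a (fun b e g => @in_c_scale _ _ _ b g) x)).
  by split=> [[mA mh mE xi]|[[mA mh mE] xi]].
- have mem_a b g : in_cs (omega B) b g -> in_a b g by case=> -[].
  apply: (iff_trans (MCc _ mem_a
    (fun b e g => @in_cs_scale _ _ _ (@omegaZ _ _ B) _ b g) x)).
  (* A cyclic structure also lists the plain membership, which is part of the symplectic one. *)
  split=> [[mA mh mE xi]|[[[mA _ mE] mh] xi]]; last by split.
  by split=> //; split=> //; split=> // i a; have [] := mh i a.
- apply: (iff_trans (MCa _ (fun b g => id) (fun b e g => @in_a_scale _ _ _ b g) x)).
  by split=> [[mA mh mE xi]|[[mA mh mE] xi]].
- have mem_a b g : in_as (omega B) b g -> in_a b g by case.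
  apply: (iff_trans (MCa _ mem_a
    (fun b e g => @in_as_scale _ _ _ (@omegaZ _ _ B) _ b g) x)).
  split=> [[mA mh mE xi]|[[[mA _ mE] mh] xi]]; last by split.
  by split=> //; split=> //; split=> // i a; have [] := mh i a.
Qed.
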